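(* Let $n=2m$, $m=2m_1$, with $m_1\equiv 1\pmod 2$ and $m_1\geq 3$, and let $a\in\mathbb{F}_{2^m}$, $a\neq 0$. The Boolean function $f_{a,1}:\mathbb{F}_{2^n}\to\mathbb{F}_2$, $$f_{a,1}(x)=\mathrm{Tr}_1^n(ax^{2^m-1})+\mathrm{Tr}_1^4(x^{\frac{2^n-1}{5}}),$$ is a hyper-bent function if and only if all of the following assertions hold. (1) $p(x)=x^5+x+a^{-1}$ is irreducible over $\mathbb{F}_{2^m}$. (2) The quadratic form $\mathfrak{q}(x)=\mathrm{Tr}_1^m(x(ax^4+ax^2+a^2x))$ over $\mathbb{F}_{2^m}$ is even. (3) $K_m(a)=\frac{4}{3}(2-2^{m_1})$.
   Context: $\mathrm{Tr}_1^k:\mathbb{F}_{2^k}\to\mathbb{F}_2$ is the absolute trace; $\mathbb{F}_{16}\subset\mathbb{F}_{2^n}$ since $4\mid n$. For $t\in\mathbb{F}_2$ put $\chi(t)=(-1)^t$. A Boolean function $f:\mathbb{F}_{2^n}\to\mathbb{F}_2$ is bent if $\sum_{x\in\mathbb{F}_{2^n}}\chi(f(x)+\mathrm{Tr}_1^n(wx))=\pm 2^{n/2}$ for all $w\in\mathbb{F}_{2^n}$; it is hyper-bent if it is bent and, for every integer $i$ with $\gcd(i,2^n-1)=1$, $x\mapsto f(x^i)$ is also bent. The Kloosterman sum is $K_m(a)=\sum_{x\in\mathbb{F}_{2^m}}\chi(\mathrm{Tr}_1^m(ax+\frac1x))$, with the convention $\frac10=0$. Parity of $\mathfrak{q}$: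 $\mathfrak{q}$ is the $\mathbb{F}_2$-valued quadratic form on the $\mathbb{F}_2$-space $\mathbb{F}_{2^m}$ associated with the symplectic form $\langle x,y\rangle_{\mathfrak q}=\mathrm{Tr}_1^m(x(ay^4+ay^2+a^2y)+y(ax^4+ax^2+a^2x))$, which is non-degenerate when $x^5+x+a^{-1}$ is irreducible over $\mathbb{F}_{2^m}$. In that case take a symplectic basis $e_1,\dots,e_{2m_1}$ of $\mathbb{F}_{2^m}$ ($2m_1=m$), i.e. $\langle e_i,e_j\rangle_{\mathfrak q}=0$ if $i\not\equiv j\pmod{m_1}$ and $\langle e_i,e_{m_1+i}\rangle_{\mathfrak q}=1$ for $1\le i\le m_1$. The form $\mathfrak q$ is called even if $\#\{i\mid 1\le i\le m_1,\ \mathfrak q(e_i)=\mathfrak q(e_{m_1+i})=1\}$ is even, and odd otherwise. *)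

(* Defs.v *)
From HB Require Import structures.
From mathcomp Require Import all_boot all_order all_algebra all_field.

Set Implicit Arguments.
Unset Strict Implicit.
Unset Printing Implicit Defensive.

Import GRing.Theory Num.Theory.
Local Open Scope ring_scope.

(* The sum x + x^2 + x^4 + ... + x^(2^(k-1)).  When x lies in the subfield      *)
(* F_{2^k} = {x | x^(2^k) = x} of a field F of characteristic 2 it is the       *)
(* absolute trace of x, as an element of the prime subfield {0, 1} of F.        *)
Definition frob_sum (F : finFieldType) (k : nat) (x : F) : F :=
  \sum_(i < k) x ^+ (2 ^ i).

(* Tr_1^k with its value read in 'F_2 (see TrE); F may be larger than F_{2^k},  *)
(* so that Tr 4 applies to elements of F_16 sitting in F_{2^n}.                 *)
Definition Tr (F : finFieldType) (k : nat) (x : F) : 'F_2 :=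
  (frob_sum k x != 0)%:R.

Lemma TrE (F : finFieldType) (k : nat) (x : F) :
  2 \in [pchar F] -> x ^+ (2 ^ k) = x -> (Tr k x : nat)%:R = frob_sum k x.
Proof.
move=> ch2 xk; suff: frob_sum k x ^+ 2 = frob_sum k x.
  rewrite /Tr; case: eqP => [-> _|/eqP nz /eqP] //=.
  by rewrite expr2 -{3}[frob_sum k x]mulr1 (inj_eq (mulfI nz)) => /eqP ->.
rewrite /frob_sum -(pFrobenius_autE ch2) rmorph_sum /=.
case: k xk => [|k] xk; first by rewrite !big_ord0.
rewrite big_ord_recr big_ord_recl /= addrC !pFrobenius_autE.
rewrite -exprM -expnSr xk expn0 expr1; congr (_ + _).
by apply: eq_bigr => i _; rewrite pFrobenius_autE -exprM -expnSr.
Qed.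

Definition chi (t : 'F_2) : int := (-1) ^+ (t : nat).

Definition bent (F : finFieldType) (n : nat) (f : F -> 'F_2) : Prop :=
  forall w : F,
    let W := \sum_(x : F) chi (f x + Tr n (w * x)) in
    W = 2 ^+ n./2 \/ W = - 2 ^+ n./2.

(* For i < 0 and x = 0, x ^ i is 0, consistently with 1/0 = 0.                  *)
Definition hyperbent (F : finFieldType) (n : nat) (f : F -> 'F_2) : Prop :=
  bent n f /\
  forall i : int, gcdz i (2 ^+ n - 1) = 1 -> bent n (fun x => f (x ^ i)).

(* MathComp sets 0^-1 = 0, which is the convention 1/0 = 0 wanted here.         *)
Definition kloosterman (F : finFieldType) (m : nat) (a : F) : int :=
  \sum_(x : F) chi (Tr m (a * x + x^-1)).

Definition qf (F : finFieldType) (m : nat) (a x : F) : 'F_2 :=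
  Tr m (x * (a * x ^+ 4 + a * x ^+ 2 + a ^+ 2 * x)).

Definition qf_sympl (F : finFieldType) (m : nat) (a x y : F) : 'F_2 :=
  Tr m (x * (a * y ^+ 4 + a * y ^+ 2 + a ^+ 2 * y)
        + y * (a * x ^+ 4 + a * x ^+ 2 + a ^+ 2 * x)).

(* Indices are 0-based: e_1, ..., e_{2 m1} is e`_0, ..., e`_(2 * m1 - 1).       *)
Definition symplectic_basis (V : vectType 'F_2) (B : V -> V -> 'F_2)
    (m1 : nat) (e : (2 * m1).-tuple V) : Prop :=
  [/\ basis_of fullv e,
      forall i j : nat, (i < 2 * m1)%N -> (j < 2 * m1)%N ->
        (i != j %[mod m1])%N -> B e`_i e`_j = 0
    & forall i : nat, (i < m1)%N -> B e`_i e`_(m1 + i) = 1].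

(* When B is non-degenerate and the polar form of q, a symplectic basis exists  *)
(* and the parity does not depend on it, so exists and forall would agree.      *)
Definition even_form (V : vectType 'F_2) (B : V -> V -> 'F_2) (q : V -> 'F_2)
    (m1 : nat) : Prop :=
  exists2 e : (2 * m1).-tuple V, symplectic_basis B e
    & ~~ odd #|[set i : 'I_m1 | (q e`_i == 1) && (q e`_(m1 + i) == 1)]|.

(* pPrimeCharType ch2 is F itself, seen as a vector space over 'F_2.            *)
Definition qf_even (F : finFieldType) (ch2 : 2 \in [pchar F]) (m1 : nat)
    (a : F) : Prop :=
  @even_form (pPrimeCharType ch2) (qf_sympl (2 * m1) a) (qf (2 * m1) a) m1.

(* a ranges over K = F_{2^m}, embedded by iota into L = F_{2^n}.                *)
Definition f_a1 (K L : finFieldType) (iota : {rmorphism K -> L}) (m n : nat)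
    (a : K) (x : L) : 'F_2 :=
  Tr n (iota a * x ^+ (2 ^ m - 1)) + Tr 4 (x ^+ ((2 ^ n - 1) %/ 5)).

(* Main.v *)
Require Import Defs.
From HB Require Import structures.
From mathcomp Require Import all_boot all_order all_algebra all_field.
From mathcomp Require Import ring zify.
Set Implicit Arguments.
Unset Strict Implicit.
Unset Printing Implicit Defensive.
Import GRing.Theory Num.Theory.
Local Open Scope ring_scope.

(* Put q = 2^m = 2^(2 m1), Kl = K_m(a) and S = sum_(t in K) chi (qf a t).       *)
(* The function f is invariant under multiplication by K*, so it is hyper-bent  *)
(* iff the sum of chi f over L* equals q - 1.  That sum reduces to the sums of  *)
(* chi (Tr (a u)) and chi (Tr (a u^5)) over the elements u of norm 1.  Pairs    *)
(* (trace, norm) of elements of L and pairs (sum, product) of elements of K     *)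
(* together cover K * K exactly twice, which evaluates these sums as 1 - Kl and *)
(* 2 S - Kl + 1; hence f is hyper-bent iff 3 Kl = 8 - 4 S.                      *)
(* A symplectic basis gives S = 2^m1 or - 2^m1 according to the parity of qf,   *)
(* and mod 3 only the former is compatible with 3 Kl = 8 - 4 S.  If qf is       *)
(* degenerate, then S = 0 or |S| >= 2 * 2^m1; the former contradicts            *)
(* 3 Kl = 8 - 4 S mod 3, and the latter makes |Kl| too large.  The bound        *)
(* (Kl - 1)^2 < 6 q comes from the covering identity, which relates (Kl - 1)^2  *)
(* to the Kloosterman sum over L, and Stepanov's method on y^2 + y = ax + 1/x + *)
(* delta over L.  Finally, the roots of X^5 + X + 1/a and the sums of two of    *)
(* them lie in the radical of qf, so that qf is degenerate as soon as this      *)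
(* quintic is reducible.                                                        *)

(** Why each link of this chain holds, and which lemma carries it. By invariance, the Walsh value of
    f at w != 0 depends only on the sum of chi f over nonzero elements and on f (1/w), so bentness
    is one equation ([bent_invariant]). Permuting L by x -> x^i preserves both the invariance and
    that sum, so for f bent and hyper-bent coincide ([hyperbent_f_a1]). The quartic trace in f only
    tests whether x is a fifth power, which leaves the norm-1 sums of u and u^5
    ([punctured_sum_f_a1]). They descend to K by [sum_norm_trace]: a polynomial X^2 + T X + N over K
    has its roots either in K or conjugate in L. The Dickson polynomial of degree 5 turns the sum of
    u^5 into the sum of the quadratic form. [sum_chi_Q] and [sum_chi_Q_sqr] evaluate S in the
    non-degenerate and in the general case. A degenerate form with S != 0 would give 9 (Kl - 1)^2 >=
    (8 * 2^m1 - 5)^2, about 64 q, against the 54 q allowed by [kloosterman_bound]; so a constant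
    weaker than Weil's 4 q suffices. Irreducibility of the quintic then follows from [qf_radical]
    and [irreducible_quintic]. *)

Definition psi (F : finFieldType) (n : nat) (x : F) : int := chi (Tr n x).

Lemma chiD (s t : 'F_2) : chi (s + t) = chi s * chi t.
Proof. by case: s t => [[|[|s]] ?] [[|[|t]] ?]. Qed.

(** * Additive characters and traces in characteristic two *)

Section CharTwo.
Variables (R : comNzRingType) (ch2 : 2 \in [pchar R]).
Implicit Types x y : R.

Lemma exprD_pow2 x y k : (x + y) ^+ (2 ^ k) = x ^+ (2 ^ k) + y ^+ (2 ^ k).
Proof.
elim: k => // k IH; rewrite expnSr !exprM IH sqrrD mulr2n (addrr_pchar2 ch2).
by rewrite addr0.
Qed.

Lemma expr_sum_pow2 (I : Type) (r : seq I) (P : pred I) (G : I -> R) k :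
  (\sum_(i <- r | P i) G i) ^+ (2 ^ k) = \sum_(i <- r | P i) G i ^+ (2 ^ k).
Proof.
elim/big_rec2: _ => [|i u v _ <-]; last by rewrite exprD_pow2.
by rewrite expr0n expn_eq0.
Qed.

Lemma pchar2_eqE x y : (x + y == 0) = (x == y).
Proof. by rewrite addr_eq0 (oppr_pchar2 ch2). Qed.

End CharTwo.

Section Trace.
Variables (F : finFieldType) (n : nat) (hF : #|F| = (2 ^ n)%N).
Let ch2 : 2 \in [pchar F] := card_finPcharP hF (isT : prime 2).
Implicit Types x y w c : F.

Lemma expr_pow2_card x : x ^+ (2 ^ n) = x.
Proof. by rewrite -hF expf_card. Qed.

Lemma dim_gt0 : (0 < n)%N.
Proof. by case: n hF (finNzRing_gt1 F) => // ->. Qed.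

Lemma frob_sumD k x y : frob_sum k (x + y) = frob_sum k x + frob_sum k y.
Proof.
by rewrite /frob_sum -big_split; apply: eq_bigr => i _; apply: exprD_pow2.
Qed.

Lemma frob_sum_sqr x : frob_sum n x ^+ 2 = frob_sum n x.
Proof.
have := TrE ch2 (expr_pow2_card x); case: (Tr n x) => [[|[|]]] //= _ <-.
  by rewrite expr0n.
by rewrite expr1n.
Qed.

Lemma frob_sum01 x : frob_sum n x = (frob_sum n x != 0)%:R.
Proof.
have /eqP := frob_sum_sqr x; rewrite -subr_eq0 expr2 -{3}[frob_sum n x]mulr1.
by rewrite -mulrBr mulf_eq0 subr_eq0 => /orP[] /eqP->; rewrite ?eqxx ?oner_eq0.
Qed.

Lemma frob_sum_expr2 x : frob_sum n (x ^+ 2) = frob_sum n x.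
Proof.
rewrite -[RHS]frob_sum_sqr (expr_sum_pow2 ch2 _ _ _ 1).
by apply: eq_bigr => i _; rewrite -!exprM mulnC.
Qed.

Lemma TrD x y : Tr n (x + y) = Tr n x + Tr n y.
Proof.
rewrite /Tr frob_sumD.
have [->|nx] := eqVneq (frob_sum n x) 0; first by rewrite !add0r.
have [->|ny] := eqVneq (frob_sum n y) 0; first by rewrite !addr0 nx.
by rewrite (frob_sum01 x) (frob_sum01 y) nx ny (addrr_pchar2 ch2) eqxx; apply/eqP.
Qed.

Lemma Tr_expr2 x : Tr n (x ^+ 2) = Tr n x.
Proof. by rewrite /Tr frob_sum_expr2. Qed.

Lemma Tr_expr_pow2 k x : Tr n (x ^+ (2 ^ k)) = Tr n x.
Proof.
elim: k => [|k IH]; first by rewrite expr1.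
by rewrite expnSr exprM Tr_expr2.
Qed.

Lemma Tr0 k : Tr k (0 : F) = 0.
Proof.
by rewrite /Tr /frob_sum big1 ?eqxx // => i _; rewrite expr0n expn_eq0.
Qed.

Lemma psiD x y : psi n (x + y) = psi n x * psi n y.
Proof. by rewrite /psi TrD chiD. Qed.

Lemma psi0 : psi n (0 : F) = 1.
Proof. by rewrite /psi Tr0. Qed.

Lemma psi_expr2 x : psi n (x ^+ 2) = psi n x.
Proof. by rewrite /psi Tr_expr2. Qed.

Lemma card_root_le (p : {poly F}) (P : pred F) :
  p != 0 -> (forall x, P x -> root p x) -> (#|P| <= (size p).-1)%N.
Proof.
move=> p0 rP; have : (size (enum P) < size p)%N.
  apply: max_poly_roots => //; last by rewrite enum_uniq.
  by apply/allP => x; rewrite mem_enum => /rP.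
by rewrite cardE; case: (size p).
Qed.

(** The trace is a polynomial function of degree 2^(n-1), which bounds the number of its roots. *)
Lemma card_trace0_le : (#|[pred x : F | frob_sum n x == 0%R]| <= 2 ^ n.-1)%N.
Proof.
pose p : {poly F} := \sum_(i < n) 'X^(2 ^ i).
have sp : size p = (2 ^ n.-1).+1.
  rewrite /p -(ltn_predK dim_gt0) big_ord_recr /= addrC size_polyDl ?size_polyXn //.
  apply: leq_ltn_trans (size_sum _ _ _) _; rewrite ltnS.
  apply/bigmax_leqP => i _; rewrite size_polyXn.
  by rewrite ltn_exp2l.
rewrite -[X in (_ <= X)%N]/((2 ^ n.-1).+1.-1) -sp; apply: card_root_le.
  by rewrite -size_poly_eq0 sp.
move=> x /= /eqP fx; apply/eqP; rewrite -[RHS]fx horner_sum.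
by apply: eq_bigr => i _; rewrite hornerXn.
Qed.

Lemma exists_trace1 : exists x : F, Tr n x = 1.
Proof.
case: (pickP [pred x : F | frob_sum n x != 0]) => [x /= hx | h0].
  by exists x; rewrite /Tr hx.
have := card_trace0_le; rewrite (eq_card (B := predT)); last first.
  by move=> x; have /negbFE := h0 x.
by rewrite hF leq_exp2l //; have := dim_gt0; case: n => // k _; rewrite ltnn.
Qed.

(* Additive Hilbert 90, by counting: y |-> y^2 + y is two-to-one, so its image  *)
(* has 2^(n-1) elements, all of trace 0.                                        *)
Lemma artin_schreier_root c : Tr n c = 0 -> exists y, y ^+ 2 + y = c.
Proof.
move=> trc; pose g y : F := y ^+ 2 + y.
have fib z : (#|[pred y : F | g y == z]| <= 2)%N.
  pose p : {poly F} := 'X^2 + ('X + (- z)%:P).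
  have sp : size p = 3%N by rewrite size_polyDl ?size_polyXn ?size_XaddC.
  rewrite -[2%N]/(3.-1) -sp; apply: card_root_le; first by rewrite -size_poly_eq0 sp.
  by move=> y /= /eqP gy; rewrite /root /p -gy /g !hornerE /= subrr.
have sub : codom g \subset [pred x : F | frob_sum n x == 0%R].
  apply/subsetP => _ /codomP[y ->]; rewrite inE frob_sumD frob_sum_expr2.
  by rewrite (addrr_pchar2 ch2).
have ge : (2 ^ n.-1 <= #|codom g|)%N.
  rewrite -(leq_pmul2r (ltn0Sn 1)) -expnSr (ltn_predK dim_gt0) -hF -sum1_card.
  rewrite (partition_big g (mem (codom g))) /=; last by move=> *; apply: codom_f.
  rewrite -sum_nat_const; apply: leq_sum => z _; rewrite sum1_card.
  exact: fib.
have eqc : #|codom g| = #|[pred x : F | frob_sum n x == 0%R]|.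
  apply/eqP; rewrite eqn_leq subset_leq_card //=.
  exact: leq_trans card_trace0_le ge.
have /codomP[y ->] : c \in codom g; last by exists y.
by rewrite (subset_cardP eqc sub) inE; move: trc; rewrite /Tr; case: eqP.
Qed.

(** Translation by an element of trace 1 changes the sign of the sum. *)
Lemma sum_psi_linear w : w != 0 -> \sum_x psi n (w * x) = 0.
Proof.
move=> w0; have [c trc] := exists_trace1.
have -> : \sum_x psi n (w * x) = \sum_(x : F) psi n x.
  by rewrite [RHS](reindex_inj (mulfI w0)).
have: \sum_(x : F) psi n x = - \sum_(x : F) psi n x.
  rewrite {1}(reindex_inj (addIr c)) /= -sumrN; apply: eq_bigr => x _.
  by rewrite psiD {2}/psi trc mulrN1.
by move/eqP; rewrite -addr_eq0 -mulr2n mulrn_eq0 => /eqP.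
Qed.

Lemma sum_psi_linear_all w :
  \sum_x psi n (w * x) = if w == 0 then 2 ^+ n else 0.
Proof.
case: eqP => [->|/eqP/sum_psi_linear //].
under eq_bigr do rewrite mul0r psi0.
by rewrite sumr_const hF natrX.
Qed.

End Trace.

Lemma pigeonhole (T T' : finType) (g : T -> T') :
  (#|T'| < #|T|)%N -> exists x y, x != y /\ g x = g y.
Proof.
move=> lt; have /injectivePn[x [y ne e]] : ~~ injectiveb g; last by exists x, y.
by apply/negP => /injectiveP /leq_card; rewrite leqNgt lt.
Qed.

(** * Stepanov's method *)

Section Stepanov.
Variables (j : nat) (F : finFieldType) (hF : #|F| = (2 ^ (2 * j.+1))%N).
Variables (a delta : F) (a0 : a != 0) (j_gt1 : (1 < j)%N).
Let ch2 : 2 \in [pchar F] := card_finPcharP hF (isT : prime 2).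
Let h : nat := (2 ^ j)%N.
Let q : nat := (2 ^ j.+1)%N.

Let qE : q = (2 * h)%N. Proof. by rewrite /q expnS. Qed.
Let h_ge4 : (4 <= h)%N. Proof. by rewrite /h -[4%N]/(2 ^ 2)%N leq_exp2l. Qed.

(* The rows of M are the coefficients of s_0, ..., s_(h-1); then [star M] is    *)
(* sum_i x^(i q) s_i and [dag M] is sum_i x^i s_i^q, so that over F, which has  *)
(* q^2 elements, (dag M)^q and star M take the same values.                     *)
Definition star d (M : 'M[F]_(h, d)) : {poly F} :=
  \sum_i \sum_k M i k *: 'X^(i * q + k).
Definition dag d (M : 'M[F]_(h, d)) : {poly F} :=
  \sum_i \sum_k M i k ^+ q *: 'X^(i + q * k).

Lemma starB d (M N : 'M[F]_(h, d)) : star (M - N) = star M - star N.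
Proof.
rewrite /star -sumrB; apply: eq_bigr => i _; rewrite -sumrB.
by apply: eq_bigr => k _; rewrite !mxE scalerBl.
Qed.

Lemma horner_dag d (M : 'M[F]_(h, d)) x : (dag M).[x] ^+ q = (star M).[x].
Proof.
rewrite !horner_sum (expr_sum_pow2 ch2); apply: eq_bigr => i _.
rewrite !horner_sum (expr_sum_pow2 ch2); apply: eq_bigr => k _.
rewrite !hornerE -/q exprMn -!exprM.
have qq : (q * q = 2 ^ (2 * j.+1))%N by rewrite /q -expnD mul2n addnn.
rewrite qq -hF expf_card mulnDl mulnAC qq -hF !exprD; congr (_ * (_ * _)).
by rewrite mulnC exprM expf_card.
Qed.

Lemma size_star d (M : 'M[F]_(h, d)) : (size (star M) + q <= h * q + d)%N.
Proof.
have hq : (q <= h * q)%N by rewrite leq_pmull // expn_gt0.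
rewrite addnC -leq_subRL; last exact: leq_trans hq (leq_addr _ _).
apply: leq_trans (size_sum _ _ _) _; apply/bigmax_leqP => i _.
apply: leq_trans (size_sum _ _ _) _; apply/bigmax_leqP => k _.
apply: leq_trans (size_scale_leq _ _) _; rewrite size_polyXn.
have := ltn_ord k; have := ltn_ord i; nia.
Qed.

(** Since i < h < q, the exponents [i + q * k] are pairwise distinct, so no two entries of [M] meet
    in one coefficient. *)
Lemma coef_dag d (M : 'M[F]_(h, d)) (i : 'I_h) (k : 'I_d) :
  (dag M)`_(i + q * k) = M i k ^+ q.
Proof.
have lt (i' : 'I_h) : (i' < q)%N by have := ltn_ord i'; lia.
rewrite coef_sum (bigD1 i) //= coef_sum (bigD1 k) //= coefZ coefXn eqxx mulr1.
rewrite !big1 ?addr0 // => [i' ne|k' ne].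
  rewrite coef_sum big1 // => k' _; rewrite coefZ coefXn.
  case: eqP => [e|_]; last by rewrite mulr0.
  case/eqP: ne; apply/val_inj; have := congr1 (modn^~ q) e.
  by rewrite /= ![(_ + q * _)%N]addnC ![(q * _)%N]mulnC !modnMDl !modn_small.
rewrite coefZ coefXn eqn_add2l eqn_pmul2l ?expn_gt0 //.
by rewrite eq_sym (inj_eq val_inj) (negPf ne) mulr0.
Qed.

Lemma dag_eq0 d (M : 'M[F]_(h, d)) : dag M = 0 -> M = 0.
Proof.
move=> d0; apply/matrixP => i k; rewrite mxE; apply/eqP.
by have := coef_dag M i k; rewrite d0 coef0 => /esym/eqP; rewrite expf_eq0 => /andP[].
Qed.

Lemma coef_dag_neq0 d (M : 'M[F]_(h, d)) e :
  (dag M)`_e != 0 -> (e %% q < h)%N /\ (e %/ q < d)%N.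
Proof.
move=> ne; suff /existsP[i /existsP[k /eqP->]] :
    [exists i : 'I_h, [exists k : 'I_d, e == (i + q * k)%N]].
  have lt : (i < q)%N by have := ltn_ord i; lia.
  by rewrite addnC mulnC modnMDl divnMDl ?expn_gt0 // modn_small ?divn_small ?addn0.
apply: contraNT ne => /existsPn ne.
rewrite coef_sum big1 // => i _; rewrite coef_sum big1 // => k _.
rewrite coefZ coefXn; by have /existsPn/(_ k)/negPf-> := ne i; rewrite mulr0.
Qed.

(* With z = x y, the curve y^2 + y = a x + 1/x + delta is z^2 = x z + cubic.     *)
Definition cubic : {poly F} := a *: 'X^3 + (delta *: 'X^2 + 'X).

Lemma size_cubic : size cubic = 4%N.
Proof.
rewrite /cubic size_polyDl size_scale ?size_polyXn //.
apply: leq_ltn_trans (size_polyD _ _) _; rewrite gtn_max size_polyX andbT.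
by apply: leq_ltn_trans (size_scale_leq _ _) _; rewrite size_polyXn.
Qed.

(* On this curve, z^(2^(i+1)) = frobC i + x^(2^(i+1) - 1) z.                      *)
Fixpoint frobC i : {poly F} :=
  if i is i'.+1 then frobC i' ^+ 2 + 'X^((2 ^ i).-1 * 2) * cubic else cubic.

(** The square of [frobC i] has degree 3 * 2^(i+1), above the degree 2^(i+2) + 1 of the added term.
    For i = j the degree is 3 h = q + h, and this shift by h mod q is what [size_dagD] exploits. *)
Lemma size_frobC i : size (frobC i) = (3 * 2 ^ i).+1.
Proof.
elim: i => [|i IH]; first exact: size_cubic.
have fi0 : frobC i != 0 by rewrite -size_poly_eq0 IH.
have s1 : size (frobC i ^+ 2) = (3 * 2 ^ i.+1).+1.
  have := size_exp (frobC i) 2; rewrite IH expnS.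
  have : (0 < size (frobC i ^+ 2)%R)%N by rewrite size_poly_gt0 expf_neq0.
  move: (size _) (2 ^ i)%N => u v; lia.
rewrite [frobC _]/= size_polyDl s1 // mulrC size_mulXn ?size_cubic.
  rewrite expnS; have : (0 < 2 ^ i)%N by rewrite expn_gt0.
  by move: (2 ^ i)%N => u; lia.
by rewrite -size_poly_eq0 size_cubic.
Qed.

Lemma horner_frobC i x z : z ^+ 2 = x * z + cubic.[x] ->
  z ^+ (2 ^ i.+1) = (frobC i).[x] + x ^+ (2 ^ i.+1).-1 * z.
Proof.
move=> hz; elim: i => [|i IH]; first by rewrite /= expr1 hz addrC.
rewrite expnSr exprM IH [LHS](exprD_pow2 ch2 _ _ 1) /= hornerD horner_exp.
rewrite -addrA; congr (_ + _); rewrite hornerM hornerXn exprMn -exprM hz.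
rewrite mulrDr addrC mulrA -exprSr; congr (_ + _); congr (_ ^+ _ * _).
rewrite expn1; have : (0 < 2 ^ i.+1)%N by rewrite expn_gt0.
by move: (2 ^ i.+1)%N => u; lia.
Qed.

Let C := frobC j.

Lemma size_mulC (p : {poly F}) : p != 0 -> size (C * p) = (3 * h + size p)%N.
Proof.
move=> p0; rewrite size_mul //; last by rewrite -size_poly_eq0 size_frobC.
by rewrite size_frobC addSn.
Qed.

Lemma size_dag_mod d (M : 'M[F]_(h, d)) :
  dag M != 0 -> ((size (dag M)).-1 %% q < h)%N /\ ((size (dag M)).-1 %/ q < d)%N.
Proof. by rewrite -lead_coef_eq0 lead_coefE => /coef_dag_neq0. Qed.

Lemma size_dag_le d (M : 'M[F]_(h, d.+1)) : (size (dag M) <= q * d + h)%N.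
Proof.
have [->|M0] := eqVneq (dag M) 0; first by rewrite size_poly0.
have [] := size_dag_mod M0; have := divn_eq (size (dag M)).-1 q.
move: (_ %/ _)%N (_ %% _)%N => u v; nia.
Qed.

(* The degree of [dag M] is congruent mod q to some i < h = q/2, that of        *)
(* [C * dag N] to some i + h: no cancellation can occur.                        *)
Lemma size_dagD d e (M : 'M[F]_(h, d)) (N : 'M[F]_(h, e)) :
  size (dag M + C * dag N) = maxn (size (dag M)) (size (C * dag N)).
Proof.
have [->|M0] := eqVneq (dag M) 0; first by rewrite add0r size_poly0 max0n.
have [->|N0] := eqVneq (dag N) 0; first by rewrite mulr0 addr0 size_poly0 maxn0.
have [ltM _] := size_dag_mod M0; have [ltN _] := size_dag_mod N0.
have M_gt0 : (0 < size (dag M))%N by rewrite size_poly_gt0.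
have N_gt0 : (0 < size (dag N))%N by rewrite size_poly_gt0.
have ne : size (dag M) != size (C * dag N).
  apply/eqP; rewrite size_mulC // => e0; move: ltM.
  have -> : ((size (dag M)).-1
      = (size (dag N)).-1 %/ q * q + q + ((size (dag N)).-1 %% q + h))%N.
    rewrite e0; have := divn_eq (size (dag N)).-1 q; lia.
  by rewrite -mulSnr modnMDl modn_small; lia.
case: (ltngtP (size (dag M)) (size (C * dag N))) ne => // lt _.
  by rewrite addrC size_polyDl //; apply/esym/maxn_idPr/ltnW.
by rewrite size_polyDl.
Qed.

Section Pairs.
Variables d e : nat.
Implicit Types (M : 'M[F]_(h, d)) (N : 'M[F]_(h, e)).

(** The two left-hand sides are the coefficients of 1 and z in dag M + z^q dag N + z (dag M' + z^q
    dag N') on the curve. If dag N' != 0, the first equation forces deg (dag N) <= deg (dag N') + 2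
    - h, and the second forces deg (dag N) >= deg (dag N') + h + 1. *)
Lemma dag_combination_eq0 M N M' N' :
  dag M + C * dag N + cubic * 'X^(q.-1) * dag N' = 0 ->
  dag M' + C * dag N' + ('X^q * dag N' + 'X^(q.-1) * dag N) = 0 ->
  [/\ M = 0, N = 0, M' = 0 & N' = 0].
Proof.
move=> e1 e2.
have cX0 : cubic * 'X^(q.-1) != 0.
  by rewrite mulf_neq0 // -size_poly_eq0 ?size_cubic ?size_polyXn.
have scX : size (cubic * 'X^(q.-1)) = (q + 3)%N.
  rewrite size_mulXn ?size_cubic; last by rewrite -size_poly_eq0 size_cubic.
  by have := h_ge4; lia.
have dE M1 N1 : dag M1 + C * dag N1 = 0 -> dag M1 = 0 /\ dag N1 = 0.
  move/(congr1 (size \o val)); rewrite /= size_dagD size_poly0 => /eqP.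
  rewrite -leqn0 geq_max !leqn0 !size_poly_eq0 mulf_eq0 -[C == 0]size_poly_eq0.
  by rewrite size_frobC => /andP[/eqP-> /eqP->].
have [N'0|N'0] := eqVneq (dag N') 0.
  move: e1 e2; rewrite N'0 !mulr0 !addr0 => /dE[M0 N0].
  by rewrite N0 mulr0 !addr0 => M'0; split; apply: dag_eq0.
exfalso.
have sN' : (0 < size (dag N'))%N by rewrite size_poly_gt0.
have s1 : (size (C * dag N)%R <= q + 2 + size (dag N'))%N.
  have := congr1 (size \o val) (addr0_eq e1); rewrite /= size_polyN size_mul //.
  rewrite scX size_dagD => sE; have := leq_maxr (size (dag M)) (size (C * dag N)).
  by rewrite sE; move: (size _) (size _) sN' => u v; lia.
have sX : size ('X^q * dag N') = (q + size (dag N'))%N.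
  by rewrite mulrC size_mulXn.
have s2 : (3 * h + size (dag N') <= size ('X^(q.-1) * dag N)%R)%N.
  have := congr1 (size \o val) (addr0_eq e2); rewrite /= size_polyN => s2.
  have le : (3 * h + size (dag N') <= size (dag M' + C * dag N')%R)%N.
    by rewrite size_dagD size_mulC // leq_maxr.
  have := size_polyD ('X^q * dag N') ('X^(q.-1) * dag N).
  rewrite -s2 sX; move: le; have := h_ge4.
  by move: (size _) (size _) (size _) => u v w; lia.
have N0 : dag N != 0.
  by apply: contraTneq s2 => ->; rewrite mulr0 size_poly0; have := h_ge4; lia.
move: s1 s2; rewrite size_mulC // mulrC size_mulXn //; have := h_ge4.
by move: (size _) (size _) sN' => u v; lia.
Qed.
End Pairs.

Let T : finType :=
  ('M[F]_(h, h.+2) * 'M[F]_(h, h.+1) * ('M[F]_(h, h.+2) * 'M[F]_(h, h.+1)))%type.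
Let eqn1 (t : T) : {poly F} :=
  star t.1.1 + C * star t.2.1 + cubic * 'X^(q.-1) * star t.2.2.
Let eqn2 (t : T) : {poly F} :=
  star t.1.2 + 'X^(q.-1) * star t.2.1 + (C + 'X^q) * star t.2.2.

(* [eqn1 t + eqn2 t * z] is sum_k nu_k^q s_k for functions nu_k = x^i, x^i z    *)
(* and s_k = A + B z on the curve; it vanishes for some nonzero family (s_k),   *)
(* and then sum_k nu_k s_k^q, of pole order too small for many zeros, vanishes  *)
(* at all rational points.                                                      *)
Lemma exists_star_solution : exists2 t : T, t != 0 & eqn1 t = 0 /\ eqn2 t = 0.
Proof.
(* The bound on the size of [C * star t.2.1], the largest of all the terms. *)
pose e := (2 * h ^ 2 + 2 * h + 2)%N.
have ss d (M : 'M[F]_(h, d)) : (size (star M) + 2 * h <= 2 * h ^ 2 + d)%N.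
  by have := size_star M; rewrite qE mulnCA -expnS.
have sC : size C = (3 * h).+1 by rewrite size_frobC.
have scX : (size (cubic * 'X^(q.-1))%R <= q + 3)%N.
  by apply: leq_trans (size_polyMleq _ _) _; rewrite size_cubic size_polyXn; lia.
have sCX : (size (C + 'X^q)%R <= (3 * h).+1)%N.
  apply: leq_trans (size_polyD _ _) _.
  by rewrite sC size_polyXn geq_max leqnn /=; lia.
have s1 t : (size (eqn1 t) <= e)%N.
  rewrite /eqn1; apply: leq_trans (size_polyD _ _) _; rewrite geq_max.
  apply/andP; split.
    apply: leq_trans (size_polyD _ _) _; rewrite geq_max; apply/andP; split.
      by have := ss _ t.1.1; rewrite /e; lia.
    apply: leq_trans (size_polyMleq _ _) _; rewrite sC.
    by have := ss _ t.2.1; rewrite /e; lia.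
  apply: leq_trans (size_polyMleq _ _) _.
  by have := ss _ t.2.2; move: scX; rewrite /e; nia.
have s2 t : (size (eqn2 t) <= e)%N.
  rewrite /eqn2; apply: leq_trans (size_polyD _ _) _; rewrite geq_max.
  apply/andP; split.
    apply: leq_trans (size_polyD _ _) _; rewrite geq_max; apply/andP; split.
      by have := ss _ t.1.2; rewrite /e; lia.
    apply: leq_trans (size_polyMleq _ _) _; rewrite size_polyXn.
    by have := ss _ t.2.1; rewrite /e; nia.
  apply: leq_trans (size_polyMleq _ _) _.
  by have := ss _ t.2.2; move: sCX; rewrite /e; lia.
pose phi t : 'rV[F]_e * 'rV[F]_e := (poly_rV (eqn1 t), poly_rV (eqn2 t)).
(* There are 4 h^2 + 6 h unknown entries for 2 e = 4 h^2 + 4 h + 4 linear conditions, and h >= 4;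
   two tuples with the same image differ by a nonzero solution. *)
have [|t [u [ne]]] := @pigeonhole T _ phi.
  rewrite !card_prod !card_mx -!expnD !mul1n ltn_exp2l ?finNzRing_gt1 // /e.
  by have := h_ge4; nia.
have inj (p r : {poly F}) : (size p <= e)%N -> (size r <= e)%N ->
    poly_rV p = poly_rV r :> 'rV_e -> p = r.
  by move=> sp sr epr; rewrite -(poly_rV_K sp) epr poly_rV_K.
case=> /(inj _ _ (s1 t) (s1 u)) e1 /(inj _ _ (s2 t) (s2 u)) e2.
exists (t - u); first by rewrite subr_eq0.
rewrite /eqn1 /eqn2 /= !starB; split.
  by rewrite -(subrr (eqn1 t)) {2}e1 /eqn1; ring.
by rewrite -(subrr (eqn2 t)) {2}e2 /eqn2; ring.
Qed.

(** The q-th power of the left-hand side is computed at a rational point: each [dag] becomes the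
    corresponding [star], z becomes z^q and z^q becomes z. The result is eqn1 + z eqn2, which is 0,
    and taking q-th powers is injective. *)
Lemma curve_point_vanish (t : T) x z : z ^+ 2 = x * z + cubic.[x] ->
  eqn1 t = 0 -> eqn2 t = 0 ->
  (dag t.1.1 + C * dag t.1.2 + cubic * 'X^(q.-1) * dag t.2.2).[x]
  + (dag t.2.1 + C * dag t.2.2 + ('X^q * dag t.2.2 + 'X^(q.-1) * dag t.1.2)).[x] * z
  = 0.
Proof.
move=> hz e1 e2; have zq := horner_frobC j hz; rewrite -/C -/q in zq.
have zqq : (z ^+ q) ^+ q = z.
  by rewrite -exprM /q -expnD addnn -mul2n -hF expf_card.
set lhs := (X in X = 0).
have -> : lhs = (dag t.1.1).[x] + z ^+ q * (dag t.1.2).[x]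
    + (z * (dag t.2.1).[x] + z ^+ q * z * (dag t.2.2).[x]).
  have xq : x ^+ q = x ^+ q.-1 * x by rewrite -exprSr prednK ?expn_gt0.
  rewrite /lhs !(hornerD, hornerM, hornerXn) zq xq.
  move: hz; rewrite /cubic !hornerD.
  move: (x ^+ q.-1) C.[x] (a *: _).[x] (delta *: _).[x] 'X.[x] => X c f3 f2 f1 hz.
  apply/eqP; rewrite -subr_eq0; apply/eqP.
  transitivity ((x * z + (f3 + (f2 + f1)) - z ^+ 2) * (X * (dag t.2.2).[x])).
    by ring.
  by rewrite hz subrr mul0r.
have q0 : (0 < q)%N by rewrite expn_gt0.
apply/eqP; rewrite -[_ == 0]andTb -q0 -expf_eq0 !(exprD_pow2 ch2).
rewrite !exprMn !horner_dag zqq.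
have <- : (eqn1 t).[x] + z * (eqn2 t).[x] = 0.
  by rewrite e1 e2 !horner0 mulr0 addr0.
apply/eqP; rewrite /eqn1 /eqn2 !(hornerD, hornerM, hornerXn) zq.
have xq : x ^+ q = x ^+ q.-1 * x by rewrite -exprSr prednK.
move: hz; rewrite xq /cubic !hornerD.
move: (x ^+ q.-1) C.[x] (a *: _).[x] (delta *: _).[x] 'X.[x] => X c f3 f2 f1 hz.
apply/eqP; rewrite -subr_eq0; apply/eqP.
transitivity ((z ^+ 2 - (x * z + (f3 + (f2 + f1)))) * (X * (star t.2.2).[x])).
  by ring.
by rewrite hz subrr mul0r.
Qed.

(** Above such an x lie two distinct points, z and z + x, so both coefficients [G1] and [G2] vanish
    at x. One of them is a nonzero polynomial; the largest term in the size estimate is C dag N,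
    with 3 h + (q h + h) = 2 h^2 + 4 h. *)
Lemma card_points_le (P : pred F) :
  (forall x, P x -> x != 0 /\ exists z, z ^+ 2 = x * z + cubic.[x]) ->
  (#|P| < 2 * h ^ 2 + 4 * h)%N.
Proof.
move=> hP; have [t t0 [e1 e2]] := exists_star_solution.
set G1 := dag t.1.1 + C * dag t.1.2 + cubic * 'X^(q.-1) * dag t.2.2.
set G2 := dag t.2.1 + C * dag t.2.2
  + ('X^q * dag t.2.2 + 'X^(q.-1) * dag t.1.2).
have rootG x : P x -> root G1 x && root G2 x.
  move=> /hP[x0 [z hz]]; have v1 := curve_point_vanish hz e1 e2.
  have hz' : (z + x) ^+ 2 = x * (z + x) + cubic.[x].
    rewrite (exprD_pow2 ch2 _ _ 1) hz; ring.
  have v2 := curve_point_vanish hz' e1 e2.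
  have /eqP : G2.[x] * x = 0.
    by rewrite -(subrr 0) -{1}v2 -{1}v1 /G1 /G2; ring.
  rewrite mulf_eq0 (negPf x0) orbF => G20.
  move: v1; rewrite -/G1 -/G2 (eqP G20) mul0r addr0 => G10.
  by rewrite /root G10 G20 eqxx.
have bound (G : {poly F}) : G != 0 -> (size G <= 2 * h ^ 2 + 4 * h)%N ->
    (forall x, P x -> root G x) -> (#|P| < 2 * h ^ 2 + 4 * h)%N.
  move=> G0 sG rG; apply: leq_trans sG.
  have := card_root_le G0 rG; move: G0; rewrite -size_poly_gt0.
  by move: #|P| (size G) => u v; lia.
have hh := h_ge4.
have s11 : (size (dag t.1.1) <= 2 * h ^ 2 + 3 * h)%N.
  by have := size_dag_le t.1.1; rewrite qE; nia.
have s12 : (size (dag t.1.2) <= 2 * h ^ 2 + h)%N.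
  by have := size_dag_le t.1.2; rewrite qE; nia.
have s21 : (size (dag t.2.1) <= 2 * h ^ 2 + 3 * h)%N.
  by have := size_dag_le t.2.1; rewrite qE; nia.
have s22 : (size (dag t.2.2) <= 2 * h ^ 2 + h)%N.
  by have := size_dag_le t.2.2; rewrite qE; nia.
have sD (p r : {poly F}) k : (size p <= k)%N -> (size r <= k)%N ->
    (size (p + r)%R <= k)%N.
  by move=> sp sr; apply: leq_trans (size_polyD _ _) _; rewrite geq_max sp.
have sM (p r : {poly F}) k l : (size p <= k.+1)%N -> (size r <= l)%N ->
    (size (p * r)%R <= k + l)%N.
  by move=> sp sr; apply: leq_trans (size_polyMleq _ _) _; lia.
have sC : (size C <= (3 * h).+1)%N by rewrite size_frobC.
have sX k : (size ('X^k : {poly F}) <= k.+1)%N by rewrite size_polyXn.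
have [G10|G10] := eqVneq G1 0.
  have [G20|G20] := eqVneq G2 0.
    case/negP: t0; have [] := dag_combination_eq0 G10 G20.
    by case: (t) => [[t1 t2] [t3 t4]] /= -> -> -> ->.
  apply: (bound G2) => // [|x /rootG/andP[] //].
  rewrite !sD //.
  - by apply: leq_trans s21 _; lia.
  - by apply: leq_trans (sM _ _ _ _ sC s22) _; lia.
  - by apply: leq_trans (sM _ _ _ _ (sX _) s22) _; lia.
  - by apply: leq_trans (sM _ _ _ _ (sX _) s12) _; lia.
apply: (bound G1) => // [|x /rootG/andP[] //].
have scX : (size (cubic * 'X^(q.-1))%R <= (q + 2).+1)%N.
  apply: leq_trans (sM _ _ 3 q _ _) _; rewrite ?size_cubic ?size_polyXn //; lia.
rewrite !sD //.
- by apply: leq_trans s11 _; lia.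
- by apply: leq_trans (sM _ _ _ _ sC s12) _; lia.
- by apply: leq_trans (sM _ _ _ _ scX s22) _; lia.
Qed.
End Stepanov.

(** Adding [delta] of trace 1 makes the trace of a x + 1/x + delta vanish, so by additive Hilbert 90
    the curve has a rational point above x. *)
Lemma card_kloosterman_trace1 (j : nat) (F : finFieldType) (a : F) :
    #|F| = (2 ^ (2 * j.+1))%N -> a != 0 -> (1 < j)%N ->
  (#|[pred x : F | (x != 0%R) && (Tr (2 * j.+1) (a * x + x^-1)%R == 1%R)]|
     < 2 * (2 ^ j) ^ 2 + 4 * 2 ^ j)%N.
Proof.
move=> hF a0 j1; have [delta trd] := exists_trace1 hF.
apply: (card_points_le hF (delta := delta) a0 j1) => x /andP[x0 /eqP trx]; split=> //.
have [y hy] : exists y, y ^+ 2 + y = a * x + x^-1 + delta.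
  apply: (artin_schreier_root hF); rewrite (TrD hF) trx trd.
  by apply/eqP.
have ch2 : 2 \in [pchar F] := card_finPcharP hF (isT : prime 2).
exists (x * y); rewrite /cubic !(hornerD, hornerZ, hornerXn, hornerX).
have -> : a * x ^+ 3 + (delta * x ^+ 2 + x) = x ^+ 2 * (y ^+ 2 + y).
  by rewrite hy; field.
transitivity ((x * y) ^+ 2 + (x ^+ 2 * y + x ^+ 2 * y)); last by ring.
by rewrite (addrr_pchar2 ch2) addr0.
Qed.

(** * Sums over the quadratic extension *)

Section QuadraticExtension.
Variables (m : nat) (K L : finFieldType).
Hypotheses (hK : #|K| = (2 ^ m)%N) (hL : #|L| = (2 ^ (2 * m))%N).
Variable iota : {rmorphism K -> L}.
Let q := (2 ^ m)%N.
Let chK : 2 \in [pchar K] := card_finPcharP hK (isT : prime 2).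
Let chL : 2 \in [pchar L] := card_finPcharP hL (isT : prime 2).

Let q_gt1 : (1 < q)%N. Proof. by rewrite /q -hK finNzRing_gt1. Qed.

Lemma expr_card_iota k : iota k ^+ q = iota k.
Proof. by rewrite -rmorphXn /q -hK expf_card. Qed.

Lemma expr_card_twice (x : L) : (x ^+ q) ^+ q = x.
Proof. by rewrite -exprM /q -expnD addnn -mul2n -hL expf_card. Qed.

Lemma fixed_codom (y : L) : y ^+ q = y -> y \in codom iota.
Proof.
move=> yq; have sub : codom iota \subset [pred z : L | z ^+ q == z].
  by apply/subsetP => _ /codomP[k ->]; rewrite inE expr_card_iota.
suff eqc : #|codom iota| = #|[pred z : L | z ^+ q == z]|.
  by rewrite (subset_cardP eqc sub) inE yq.
apply/eqP; rewrite eqn_leq subset_leq_card //= card_codom; last exact: fmorph_inj.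
have sp : size ('X^q - 'X : {poly L}) = q.+1.
  by rewrite size_polyDl ?size_polyN ?size_polyXn ?size_polyX.
rewrite hK; apply: leq_trans (card_root_le (p := 'X^q - 'X) _ _) _; last by rewrite sp.
  by rewrite -size_poly_eq0 sp.
by move=> z /= /eqP zq; rewrite /root !hornerE zq /= subrr.
Qed.

(** Inverse of [iota] on its image, with default 0 elsewhere; by [descentK] the default is never met
    on elements fixed by the q-power map, such as traces and norms. *)
Definition descent (y : L) : K := odflt 0 [pick k | iota k == y].

Lemma descentK y : y ^+ q = y -> iota (descent y) = y.
Proof.
move/fixed_codom/codomP => [k ->]; rewrite /descent; case: pickP => [k' /eqP //|].
by move/(_ k); rewrite eqxx.
Qed.

Definition relTr (x : L) : K := descent (x + x ^+ q).
Definition relNm (x : L) : K := descent (x * x ^+ q).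

Lemma relTrE x : iota (relTr x) = x + x ^+ q.
Proof. by apply: descentK; rewrite (exprD_pow2 chL) expr_card_twice addrC. Qed.

Lemma relNmE x : iota (relNm x) = x * x ^+ q.
Proof. by apply: descentK; rewrite exprMn expr_card_twice mulrC. Qed.

Lemma Tr_relTr k x : Tr (2 * m) (iota k * x) = Tr m (k * relTr x).
Proof.
suff e : frob_sum (2 * m) (iota k * x) = iota (frob_sum m (k * relTr x)).
  by rewrite /Tr e fmorph_eq0.
rewrite /frob_sum rmorph_sum mul2n -addnn big_split_ord /= -big_split /=.
apply: eq_bigr => i _; rewrite rmorphXn rmorphM relTrE mulrDr (exprD_pow2 chL).
by congr (_ + _); rewrite expnD exprM exprMn -/q expr_card_iota.
Qed.

Definition nt_fiber T N := [pred x : L | (relTr x == T) && (relNm x == N)].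
Definition sp_fiber T N := [pred u : K * K | (u.1 + u.2 == T) && (u.1 * u.2 == N)].

Lemma nt_fiber_root T N x : x \in nt_fiber T N ->
  x ^+ 2 + iota T * x + iota N = 0.
Proof.
case/andP => /eqP <- /eqP <-; rewrite relTrE relNmE.
have -> : x ^+ 2 + (x + x ^+ q) * x + x * x ^+ q
  = (x ^+ 2 + x * x ^+ q) + (x ^+ 2 + x * x ^+ q) by ring.
exact: addrr_pchar2 chL _.
Qed.

(** Both fibers consist of roots of X^2 + T X + N. For T = 0 the only root is the square root of N,
    counted at most once on each side. For T != 0, a split polynomial has all its roots in K, where
    the relative trace is 0, so the first fiber is empty and the second is a pair and its swap. *)
Lemma card_fibers_le T N : (#|nt_fiber T N| + #|sp_fiber T N| <= 2)%N.
Proof.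
have [->|T0] := eqVneq T 0.
  apply: (@leq_add _ _ 1 1).
    apply/card_le1_eqP => x y /nt_fiber_root ex /nt_fiber_root ey.
    apply/eqP; rewrite -(pchar2_eqE chL) -sqrf_eq0 (exprD_pow2 chL _ _ 1) expn1.
    move: ex ey; rewrite rmorph0 !mul0r !addr0 => /eqP; rewrite (pchar2_eqE chL).
    by move=> /eqP-> /eqP; rewrite (pchar2_eqE chL).
  apply/card_le1_eqP => -[x x'] [y y'] /andP[/= ex nx] /andP[/= ey ny].
  move: ex ey nx ny; rewrite !(pchar2_eqE chK) => /eqP<- /eqP<- /eqP <- /eqP.
  move/eqP; rewrite -!expr2 -(pchar2_eqE chK) -(exprD_pow2 chK _ _ 1) sqrf_eq0.
  by rewrite (pchar2_eqE chK) => /eqP->.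
have [u hu|u0] := pickP (sp_fiber T N); last first.
  rewrite (eq_card0 u0) addn0.
  have sp : size ('X^2 + (iota T *: 'X + (iota N)%:P) : {poly L}) = 3%N.
    rewrite size_polyDl size_polyXn // ltnS; apply: leq_trans (size_polyD _ _) _.
    rewrite geq_max (leq_trans (size_scale_leq _ _)) ?size_polyX //=.
    by rewrite (leq_trans (size_polyC_leq1 _)).
  rewrite -[2%N]/(3.-1) -sp; apply: card_root_le.
    by rewrite -size_poly_eq0 sp.
  by move=> x /nt_fiber_root e; rewrite /root !hornerE /= ?addrA e.
have /andP[/eqP eT /eqP eN] := hu.
rewrite [X in (X + _)%N]eq_card0 => [|x]; last first.
  apply/negP => hx; have := nt_fiber_root hx; case/andP: hx => /eqP ex _.
  have -> : x ^+ 2 + iota T * x + iota N = (x + iota u.1) * (x + iota u.2).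
    by rewrite -eT -eN rmorphD rmorphM; ring.
  move/eqP; rewrite mulf_eq0 !(pchar2_eqE chL) => xu.
  case/negP: T0; rewrite -(fmorph_eq0 iota) -ex relTrE.
  by case/orP: xu => /eqP->; rewrite expr_card_iota (addrr_pchar2 chL).
rewrite add0n; apply: leq_trans (_ : #|pred2 u (u.2, u.1)| <= 2)%N; last first.
  by rewrite card2; case: (_ == _).
apply: subset_leq_card; apply/subsetP => -[x y] /andP[/= /eqP sxy /eqP pxy].
have ey : y = x + (u.1 + u.2).
  by rewrite eT -sxy addrA (addrr_pchar2 chK) add0r.
have /eqP : (x + u.1) * (x + u.2) = 0.
  transitivity ((x * (x + (u.1 + u.2))) + u.1 * u.2); first by ring.
  by rewrite -ey pxy eN (addrr_pchar2 chK).
rewrite mulf_eq0 !(pchar2_eqE chK) ey inE => /orP[] /eqP->.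
  by rewrite addrA (addrr_pchar2 chK) add0r -surjective_pairing eqxx.
by rewrite [u.1 + _]addrC addrA (addrr_pchar2 chK) add0r eqxx orbT.
Qed.

(* Both sides of [card_fibers_le] sum to 2 q^2, hence equality for all T, N.    *)
Lemma card_fibers T N : (#|nt_fiber T N| + #|sp_fiber T N| = 2)%N.
Proof.
have le (p : K * K) : (#|nt_fiber p.1 p.2| + #|sp_fiber p.1 p.2| <= 2)%N.
  exact: card_fibers_le.
have : (\sum_(p : K * K) (2 - (#|nt_fiber p.1 p.2| + #|sp_fiber p.1 p.2|)) = 0)%N.
  rewrite sumnB; last by move=> p _; apply: le.
  rewrite big_split /= sum_nat_const card_prod hK.
  have -> : (\sum_(p : K * K) #|nt_fiber p.1 p.2| = #|L|)%N.
    rewrite -sum1_card (partition_big (fun x => (relTr x, relNm x)) xpredT) //=.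
    by apply: eq_bigr => -[T' N'] _; rewrite -sum1_card; apply: eq_bigl.
  have -> : (\sum_(p : K * K) #|sp_fiber p.1 p.2| = #|{: K * K}|)%N.
    rewrite -sum1_card.
    rewrite [RHS](partition_big (fun u => (u.1 + u.2, u.1 * u.2)%R) xpredT) //=.
    by apply: eq_bigr => -[T' N'] _; rewrite -sum1_card; apply: eq_bigl.
  by rewrite card_prod hK hL mul2n -addnn expnD; lia.
move/eqP; rewrite sum_nat_eq0 => /forallP/(_ (T, N)) /=; rewrite subn_eq0 => ge.
by apply/eqP; rewrite eqn_leq ge card_fibers_le.
Qed.

Lemma sum_norm_trace (G : K -> K -> int) :
  \sum_(x : L) G (relTr x) (relNm x)
    + \sum_(u : K * K) G (u.1 + u.2) (u.1 * u.2)
  = 2 * \sum_(p : K * K) G p.1 p.2.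
Proof.
rewrite (partition_big (fun x => (relTr x, relNm x)) xpredT) //=.
rewrite [X in _ + X](partition_big (fun u => (u.1 + u.2, u.1 * u.2)) xpredT) //=.
rewrite -big_split mulr_sumr; apply: eq_bigr => -[T N] _ /=.
rewrite (eq_bigr (fun=> G T N)) => [|x /eqP[-> ->] //].
rewrite [X in _ + X](eq_bigr (fun=> G T N)) => [|u /eqP[-> ->] //].
rewrite !sumr_const -mulrnDr -[2]/(2%:R) mulr_natl; congr (_ *+ _).
exact: card_fibers.
Qed.

Lemma relNm_eq1 x : (relNm x == 1) = (x * x ^+ q == 1).
Proof. by rewrite -relNmE fmorph_eq1. Qed.

Lemma relNm_eq0 x : (relNm x == 0) = (x == 0).
Proof.
rewrite -(fmorph_eq0 iota) relNmE mulf_eq0 expf_eq0.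
by rewrite (ltnW q_gt1) /= orbb.
Qed.

Lemma sum_norm1 (H : K -> int) :
  \sum_(x : L | x * x ^+ q == 1) H (relTr x) + \sum_(x : K | x != 0) H (x + x^-1)
  = 2 * \sum_T H T.
Proof.
have := sum_norm_trace (fun T N => if N == 1 then H T else 0).
rewrite -big_mkcond (eq_bigl _ _ relNm_eq1) => e.
transitivity (2 * \sum_(p : K * K) if p.2 == 1 then H p.1 else 0); last first.
  congr (_ * _); rewrite -(pair_bigA _ (fun T N => if N == 1 then H T else 0)) /=.
  by apply: eq_bigr => T _; rewrite -big_mkcond big_pred1_eq.
rewrite -e; congr (_ + _).
rewrite -(pair_bigA _ (fun x y => if x * y == 1 then H (x + y) else 0)) /=.
rewrite big_mkcond; apply: eq_bigr => x _.
case: eqVneq => [->|x0] /=.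
  by rewrite big1 // => y _; rewrite mul0r eq_sym oner_eq0.
rewrite (bigD1 x^-1) //= mulfV // eqxx big1 ?addr0 // => y.
by rewrite -(inj_eq (mulfI x0)) mulfV // => /negPf->.
Qed.

(** The Dickson polynomial t^5 - 5 t^3 + 5 t, which sends x + 1/x to x^5 + 1/x^5, with coefficients
    reduced mod 2. *)
Definition dickson5 (R : comNzRingType) (t : R) := t ^+ 5 + t ^+ 3 + t.

Lemma dickson5_add (R : comNzRingType) (x y : R) : 2 \in [pchar R] -> x * y = 1 ->
  x ^+ 5 + y ^+ 5 = dickson5 (x + y).
Proof.
move=> ch2 xy; pose s := x + y; pose k : R := 2 * s - 3 * s ^+ 3.
transitivity (dickson5 s + (k + k)
    + (x * y - 1) * (5 * (x * y + 1) * s - 5 * s ^+ 3)).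
  by rewrite /k /s /dickson5; ring.
by rewrite xy subrr mul0r addr0 (addrr_pchar2 ch2) addr0.
Qed.

Lemma psi_dickson5 a (t : K) : psi m (a * dickson5 t) = chi (qf m a t).
Proof.
have -> : a * dickson5 t = (a * t ^+ 5 + a * t ^+ 3) + a * t.
  by rewrite /dickson5; ring.
rewrite (psiD hK) -(psi_expr2 hK (a * t)) -(psiD hK) /psi /qf.
by congr (chi (Tr _ _)); ring.
Qed.

Lemma sum_norm1_psi (a : K) :
  \sum_(x : L | x * x ^+ q == 1) psi (2 * m) (iota a * x)
    + \sum_(x : K | x != 0) psi m (a * (x + x^-1))
  = 2 * \sum_t psi m (a * t).
Proof.
rewrite -sum_norm1; congr (_ + _); apply: eq_bigr => x _.
by rewrite /psi Tr_relTr.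
Qed.

Lemma sum_norm1_psi5 (a : K) :
  \sum_(x : L | x * x ^+ q == 1) psi (2 * m) (iota a * x ^+ 5)
    + \sum_(x : K | x != 0) psi m (a * (x ^+ 5 + (x ^+ 5)^-1))
  = 2 * \sum_t chi (qf m a t).
Proof.
under [in RHS]eq_bigr do rewrite -psi_dickson5.
rewrite -sum_norm1; congr (_ + _); apply: eq_bigr => x hx.
  rewrite /psi Tr_relTr; congr (chi (Tr _ (_ * _))); apply: (fmorph_inj iota).
  rewrite relTrE exprAC (dickson5_add chL (eqP hx)) -relTrE.
  by rewrite /dickson5 !rmorphD !rmorphXn.
by rewrite -exprVn (dickson5_add chK) ?mulfV.
Qed.

(** The substitution x = a w^2 turns a (x + 1/x) into (a w + 1/w)^2, which has the same trace as a w
    + 1/w. The term 1 subtracted is the one of x = 0. *)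
Lemma sum_psi_inv (a : K) : a != 0 ->
  \sum_(x : K | x != 0) psi m (a * (x + x^-1)) = kloosterman m a - 1.
Proof.
move=> a0; rewrite /kloosterman [X in X - 1](bigD1 0) //= invr0 mulr0 addr0.
rewrite -/(psi m 0) psi0 [1 + _]addrC addrK.
have inj : injective (fun w : K => a * w ^+ 2).
  move=> x y /(mulfI a0) /eqP; rewrite -(pchar2_eqE chK).
  rewrite -(exprD_pow2 chK _ _ 1) sqrf_eq0 (pchar2_eqE chK) => /eqP; exact.
rewrite (reindex_inj inj) /=; apply: eq_big => w.
  by rewrite mulf_eq0 (negPf a0) sqrf_eq0.
move=> _; rewrite -[RHS](psi_expr2 hK); congr (psi _ _).
rewrite (exprD_pow2 chK _ _ 1) exprMn mulrDr invfM mulVKf // exprVn.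
by rewrite mulrA -expr2.
Qed.

(** The covering identity is applied to psi (a T + T / N), because 1/x has relative trace T / N and
    1/x + 1/y = (x + y) / (x y). For fixed N this is linear in T with slope a + 1/N, so only N = 1/a
    contributes, with q. *)
Lemma sum_psi_lift (a : K) : a != 0 ->
  \sum_(x : L | x != 0) psi (2 * m) (iota a * x + x^-1)
    + (\sum_(x : K | x != 0) psi m (a * x + x^-1)) ^+ 2
  = 2 * 2 ^+ m.
Proof.
move=> a0.
pose G (T N : K) : int := if N == 0 then 0 else psi m (a * T + T / N).
have -> : \sum_(x : L | x != 0) psi (2 * m) (iota a * x + x^-1)
    = \sum_(x : L) G (relTr x) (relNm x).
  rewrite big_mkcond; apply: eq_bigr => x _; rewrite /G relNm_eq0.
  case: eqVneq => //= x0; rewrite (psiD hL) (psiD hK) /psi Tr_relTr.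
  congr (_ * _); have := Tr_relTr 1 x^-1; rewrite rmorph1 !mul1r => ->.
  congr (chi (Tr _ _)); apply: (fmorph_inj iota).
  rewrite relTrE fmorph_div relTrE relNmE exprVn invfM mulrA mulrDl mulfV //.
  by rewrite mulrDl mul1r [_ * _ * _]mulrAC mulfV ?mul1r 1?addrC // expf_neq0.
have -> : (\sum_(x : K | x != 0) psi m (a * x + x^-1)) ^+ 2
    = \sum_(u : K * K) G (u.1 + u.2) (u.1 * u.2).
  rewrite -(pair_bigA _ (fun x y => G (x + y) (x * y))) /=.
  rewrite expr2 big_mkcond mulr_suml; apply: eq_bigr => x _.
  rewrite mulr_sumr; apply: eq_bigr => y _; rewrite /G mulf_eq0.
  case: eqVneq => [|x0] /=; first by rewrite mul0r.
  case: eqVneq => [|y0] /=; first by rewrite mulr0.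
  rewrite -(psiD hK); congr (psi _ _); field; exact/andP.
rewrite sum_norm_trace; congr (_ * _).
rewrite -(pair_bigA _ G) exchange_big (bigD1 a^-1) //= [X in _ + X]big1.
  rewrite addr0 /G invr_eq0 (negPf a0) (eq_bigr (fun=> 1)) => [|T _].
    by rewrite sumr_const hK natrX.
  by rewrite invrK mulrC (addrr_pchar2 chK) (psi0 _ _).
move=> N neN; rewrite /G; case: eqVneq => [|N0]; first by rewrite big1.
rewrite -[RHS](sum_psi_linear hK (w := a + N^-1)).
  by apply: eq_bigr => T _; rewrite mulrDl [T / N]mulrC.
by rewrite (pchar2_eqE chK) -(inj_eq invr_inj) invrK eq_sym.
Qed.
End QuadraticExtension.

(** * Power maps on a finite field *)

Section PowerMaps.
Variable F : finFieldType.
Let N := (#|F|.-1)%N.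

Lemma expf_card_pred (x : F) : x != 0 -> x ^+ N = 1.
Proof.
move=> x0; apply: (mulIf x0).
by rewrite -exprSr prednK ?expf_card ?mul1r // ltnW ?finNzRing_gt1.
Qed.

Lemma exprz_inj (i : int) : gcdz i N%:Z = 1 -> i != 0 ->
  injective (fun x : F => x ^ i).
Proof.
move=> gi i0 x y /= e.
have [x0|x0] := eqVneq x 0.
  move: e; rewrite x0 exp0rz (negPf i0) => /esym/eqP.
  by rewrite expfz_eq0 (negPf i0) /= => /eqP.
have y0 : y != 0.
  apply: contraNneq x0 => y0; move: e; rewrite y0 exp0rz (negPf i0) => /eqP.
  by rewrite expfz_eq0 i0.
pose z := x / y; have z0 : z != 0 by rewrite mulf_neq0 ?invr_eq0.
have zi : z ^ i = 1 by rewrite expfzMl e -expfzMl mulfV ?exp1rz.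
have [u [v uv]] := Bezoutz i N%:Z.
suff : z = 1 by move/(congr1 (fun t => t * y)); rewrite mulfVK ?mul1r.
rewrite -[z]expr1z -gi -uv expfzDr // [u * i]mulrC [v * _]mulrC -!exprz_exp.
by rewrite zi -exprnP expf_card_pred // !exp1rz mulr1.
Qed.

(* Each z is the d-th power of at most d elements, and the d-th powers lie among *)
(* the at most N/d roots of X^(N/d) - 1; both bounds are attained since their    *)
(* product is N.                                                                 *)
Lemma sum_expr_dvd (d : nat) (H : F -> int) : (d %| N)%N ->
  \sum_(x | x != 0) H (x ^+ d) = d%:R * \sum_(z | z ^+ (N %/ d) == 1) H z.
Proof.
move=> dN; have N0 : (0 < N)%N.
  by rewrite -ltnS prednK ?finNzRing_gt1 // ltnW ?finNzRing_gt1.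
have d0 : (0 < d)%N by apply: dvdn_gt0 dN.
pose P := [pred z : F | z ^+ (N %/ d) == 1].
pose fib z := [pred x : F | (x != 0) && (x ^+ d == z)].
have Nd0 : (0 < N %/ d)%N by rewrite divn_gt0 // dvdn_leq.
have cardP : (#|P| <= N %/ d)%N.
  have sp : size ('X^(N %/ d) - 1%:P : {poly F}) = (N %/ d).+1 by rewrite size_XnsubC.
  apply: leq_trans (card_root_le (p := 'X^(N %/ d) - 1%:P) _ _) _; last by rewrite sp.
    by rewrite -size_poly_eq0 sp.
  by move=> z /= /eqP zq; rewrite /root !hornerE zq /= subrr.
have fib_le z : (#|fib z| <= d)%N.
  have sp : size ('X^d - z%:P : {poly F}) = d.+1 by rewrite size_XnsubC.
  apply: leq_trans (card_root_le (p := 'X^d - z%:P) _ _) _; last by rewrite sp.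
    by rewrite -size_poly_eq0 sp.
  by move=> x /= /andP[_ /eqP xz]; rewrite /root !hornerE xz /= subrr.
have mapP x : x != 0 -> P (x ^+ d).
  by move=> x0; rewrite /P /= -exprM mulnC divnK // expf_card_pred.
have sumN : (\sum_(z | P z) #|fib z| = N)%N.
  have -> : N = #|[pred x : F | x != 0%R]|.
    by rewrite -[RHS]/(#|predC1 (0%R : F)|) -[LHS]/(_.-1) (cardC1 (0 : F)).
  rewrite -[RHS]sum1_card [RHS](partition_big (fun x => x ^+ d) P) //=.
  by apply: eq_bigr => z _; rewrite -sum1_card.
have fibE z : P z -> #|fib z| = d.
  move=> Pz; apply/eqP; rewrite eqn_leq fib_le /=.
  have : (\sum_(z | P z) (d - #|fib z|) = 0)%N.
    rewrite sumnB; last by move=> *; apply: fib_le.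
    rewrite sumN sum_nat_const; apply/eqP; rewrite subn_eq0 -leq_divRL //.
  by move/eqP; rewrite sum_nat_eq0 => /forallP/(_ z); rewrite Pz subn_eq0.
rewrite (partition_big (fun x => x ^+ d) P) //= mulr_sumr.
apply: eq_bigr => z Pz; rewrite (eq_bigr (fun=> H z)) => [|x /andP[_ /eqP->] //].
by rewrite sumr_const mulr_natl -[in RHS](fibE z Pz).
Qed.

End PowerMaps.

(** The two numbers differ by 2, while q - 1 >= 3. *)
Lemma pred_ndvd_succ (q : nat) (t : int) :
  (4 <= q)%N -> (q%:Z - 1) * t = q%:Z + 1 -> False.
Proof.
move=> q4 e; have [t1|t1] : (t <= 1) \/ (2 <= t) by lia.
  by nia.
by nia.
Qed.

(** * Walsh sums of functions invariant under nonzero scalars of K, and their value for f *)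

Section BentSums.
Variables (m : nat) (K L : finFieldType).
Hypotheses (hK : #|K| = (2 ^ m)%N) (hL : #|L| = (2 ^ (2 * m))%N).
Variable iota : {rmorphism K -> L}.
Let q := (2 ^ m)%N.
Let chL : 2 \in [pchar L] := card_finPcharP hL (isT : prime 2).

Let q_pred : q.-1%:R = q%:R - 1 :> int.
Proof. by rewrite -subn1 natrB // expn_gt0. Qed.

Definition punctured_sum (g : L -> 'F_2) : int := \sum_(x | x != 0) chi (g x).

Section Invariant.
Variable g : L -> 'F_2.
Hypotheses (g0 : g 0 = 0) (gK : forall (y : K) (x : L), y != 0 -> g (iota y * x) = g x).

(** Relative trace 0 means w x lies in K, so x is a nonzero K-multiple of 1/w and g takes there the
    value g (1/w). *)
Lemma sum_relTr0 (w : L) : w != 0 ->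
  \sum_(x | (x != 0) && (relTr m iota (w * x) == 0)) chi (g x)
  = (q%:R - 1) * chi (g w^-1).
Proof.
move=> w0.
rewrite (reindex_onto (fun y => iota y / w) (fun x => descent iota (w * x))).
  rewrite (eq_bigl (fun y : K => y != 0)) => [|y].
    rewrite (eq_bigr (fun=> chi (g w^-1))) => [|y y0]; last by rewrite gK.
    by rewrite sumr_const (cardC1 (0 : K)) hK -/q -[LHS]mulr_natl q_pred.
  have iy : w * (iota y / w) = iota y by rewrite mulrC mulfVK.
  have dy : descent iota (iota y) = y.
    by apply: (fmorph_inj iota); rewrite (descentK hK) // (expr_card_iota hK).
  rewrite mulf_eq0 invr_eq0 (negPf w0) orbF fmorph_eq0 iy dy eqxx andbT.
  rewrite -(fmorph_eq0 iota (relTr _ _ _)) (relTrE hK hL) (expr_card_iota hK).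
  by rewrite (addrr_pchar2 chL) eqxx andbT.
move=> x /andP[_ /eqP tr0]; rewrite (descentK hK); first by rewrite mulrC mulKf.
apply/esym/eqP; rewrite -(pchar2_eqE chL); have := relTrE hK hL iota (w * x).
by rewrite tr0 rmorph0 => <-.
Qed.

(* Averaging over x |-> iota y * x for y in K*, under which g is invariant.     *)
Lemma walsh_invariant (w : L) : w != 0 ->
  (q%:R - 1) * \sum_x chi (g x + Tr (2 * m) (w * x))
  = (q%:R - 1) * (1 + q%:R * chi (g w^-1)) - punctured_sum g.
Proof.
move=> w0; rewrite (bigD1 0) //= g0 mulr0 Tr0 addr0 [chi 0]expr0.
suff e : (q%:R - 1) * \sum_(x | x != 0) chi (g x + Tr (2 * m) (w * x))
    = q%:R * ((q%:R - 1) * chi (g w^-1)) - punctured_sum g.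
  by rewrite mulrDr e; ring.
have q1 : #|[pred y : K | y != 0%R]|%:R = q%:R - 1 :> int.
  by rewrite -q_pred /q -hK -(cardC1 (0 : K)).
rewrite -[in LHS]q1 [LHS]mulr_natl -sumr_const.
transitivity (\sum_(y : K | y != 0) \sum_(x | x != 0)
    chi (g x) * psi (2 * m) (iota y * (w * x))).
  apply: eq_bigr => y y0; have iy0 : iota y != 0 by rewrite fmorph_eq0.
  rewrite (reindex_inj (mulfI iy0)) /=; apply: eq_big => x.
    by rewrite mulf_eq0 (negPf iy0).
  by move=> _; rewrite gK // chiD mulrCA.
rewrite exchange_big -sum_relTr0 // [X in _ * X]big_mkcondr /= mulr_sumr.
rewrite -sumrB; apply: eq_bigr => x x0; rewrite -mulr_sumr.
have := sum_psi_linear_all hK (relTr m iota (w * x)).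
rewrite (bigD1 0) //= mulr0 (psi0 _ m) => /(canRL (addKr 1)) e.
rewrite (eq_bigr (fun y => psi m (relTr m iota (w * x) * y))) => [|y _]; last first.
  by rewrite /psi (Tr_relTr hK hL) mulrC.
by rewrite e natrX; case: ifP => _; ring.
Qed.

Lemma walsh0_invariant : \sum_x chi (g x + Tr (2 * m) (0 * x)) = 1 + punctured_sum g.
Proof.
rewrite (bigD1 0) //= g0 mulr0 Tr0 addr0 [chi 0]expr0; congr (_ + _).
by apply: eq_bigr => x _; rewrite mul0r Tr0 addr0.
Qed.

(** The Walsh value at 0 is 1 + [punctured_sum g]. If it is q, [walsh_invariant] gives q chi (g
    (1/w)) at every w != 0; if it were -q, the same formula at w = 1 would make q - 1 divide q +
    1. *)
Lemma bent_invariant : (1 < m)%N -> bent (2 * m) g <-> punctured_sum g = 2 ^+ m - 1.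
Proof.
move=> m1; have q4 : (4 <= q)%N by rewrite /q -[4%N]/(2 ^ 2)%N leq_exp2l.
have qE : 2 ^+ m = q%:R :> int by rewrite natrX.
have q0 : q%:R - 1 != 0 :> int.
  by rewrite subr_eq0 (eqr_nat _ q 1); apply: contraTneq q4 => ->.
rewrite /bent mul2n doubleK qE -mul2n; split=> [bg|sg w].
  have := bg 0; rewrite /= walsh0_invariant => -[<-|e]; first by ring.
  have := walsh_invariant (oner_neq0 L).
  have -> : punctured_sum g = - q%:R - 1 by apply: (addrI 1); rewrite e; ring.
  move: (\sum_x _) (chi _) => W c eW.
  have {eW} : (q%:R - 1) * (W - 1 - q%:R * c) = q%:R + 1.
    move/eqP: eW; rewrite -subr_eq0 => /eqP eW.
    by apply/eqP; rewrite -subr_eq0 -eW; apply/eqP; ring.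
  by rewrite natz => /(pred_ndvd_succ q4).
have [->|w0] := eqVneq w 0.
  by left; rewrite /= walsh0_invariant sg; ring.
have := walsh_invariant w0; rewrite sg => eW.
have {eW} -> : \sum_x chi (g x + Tr (2 * m) (w * x)) = q%:R * chi (g w^-1).
  by apply: (mulfI q0); rewrite eW; ring.
by rewrite /chi; case: (g w^-1) => [[|[|k]] hk] //=; [left | right]; ring.
Qed.
End Invariant.

Section Exponents.
Variable a : K.
Hypothesis m5 : (5 %| 2 ^ m + 1)%N.
Let f := f_a1 iota m (2 * m) a.

Let q_gt1 : (1 < q)%N. Proof. by rewrite /q -hK finNzRing_gt1. Qed.
Let cardE : (2 ^ (2 * m) - 1 = (q - 1) * (q + 1))%N.
Proof. by rewrite mul2n -addnn expnD -/q; move: q_gt1; nia. Qed.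
Let divE : ((2 ^ (2 * m) - 1) %/ 5 = (q - 1) * ((q + 1) %/ 5))%N.
Proof. by rewrite cardE muln_divA. Qed.

(** The exponents 1, 2, 4, 8 are 1, 2, 4, 3 mod 5, and the nontrivial powers of a fifth root of
    unity z != 1 add up to -1 = 1. *)
Lemma chi_Tr4 (z : L) : z ^+ 5 = 1 -> chi (Tr 4 z) = if z == 1 then 1 else -1.
Proof.
move=> z5; have e8 : z ^+ 8 = z ^+ 3 by rewrite (exprD z 5 3) z5 mul1r.
rewrite /Tr /frob_sum !big_ord_recr big_ord0 /= add0r expr1 e8.
rewrite -[(2 ^ 1)%N]/2%N -[(2 ^ 2)%N]/4%N.
have [->|z1] := eqVneq z 1.
  by rewrite !expr1n (addrr_pchar2 chL) add0r (addrr_pchar2 chL) eqxx.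
suff -> : z + z ^+ 2 + z ^+ 4 + z ^+ 3 = 1 by rewrite oner_eq0.
have z10 : z - 1 != 0 by rewrite subr_eq0.
apply: (mulfI z10); apply/eqP; rewrite -subr_eq0.
have -> : (z - 1) * (z + z ^+ 2 + z ^+ 4 + z ^+ 3) - (z - 1) * 1
  = z ^+ 5 + 1 - (z + z) by ring.
by rewrite z5 !(addrr_pchar2 chL) subr0.
Qed.

Lemma f_a1_0 : f 0 = 0.
Proof.
have hd : (0 < (q + 1) %/ 5)%N by rewrite divn_gt0 // dvdn_leq // addn1.
rewrite /f /f_a1 !expr0n divE -/q.
have -> : (q - 1 == 0)%N = false by move: q_gt1; lia.
have -> : ((q - 1) * ((q + 1) %/ 5) == 0)%N = false by move: q_gt1 hd; nia.
by rewrite mulr0 !Tr0 addr0.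
Qed.

Lemma f_a1_invariant (y : K) (x : L) : y != 0 -> f (iota y * x) = f x.
Proof.
move=> y0; rewrite /f /f_a1 divE -/q !exprMn !exprM.
suff -> : iota y ^+ (q - 1) = 1 by rewrite expr1n !mul1r.
by rewrite -rmorphXn subn1 /q -hK expf_card_pred // rmorph1.
Qed.

(** By [chi_Tr4] the quartic factor is 2 [x is a fifth power] - 1. Replacing a sum over fifth powers
    by a fifth of the sum over all x^5 gives (q - 1) (2 S5 - 5 S1), where Sk is the norm-1 sum of
    psi (a u^k). *)
Lemma punctured_sum_f_a1 : a != 0 -> 5 * punctured_sum f
  = (2 ^+ m - 1) * (4 * \sum_t chi (qf m a t) + 3 * kloosterman m a - 3).
Proof.
move=> a0.
pose S k := \sum_(x : L | x * x ^+ q == 1) psi (2 * m) (iota a * x ^+ k).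
have dv : ((q - 1) %| #|L|.-1)%N by rewrite hL -subn1 cardE dvdn_mulr.
have dv5 : (5 %| #|L|.-1)%N by rewrite hL -subn1 cardE dvdn_mull.
have qE : (q - 1)%N%:R = 2 ^+ m - 1 :> int by rewrite natrB ?natrX // ltnW.
have Sk k : \sum_(x : L | x != 0) psi (2 * m) (iota a * (x ^+ (q - 1)) ^+ k)
    = (2 ^+ m - 1) * S k.
  rewrite (sum_expr_dvd (fun z => psi (2 * m) (iota a * z ^+ k)) dv) qE.
  congr (_ * _); apply: eq_bigl => x; rewrite hL -subn1 cardE.
  by rewrite mulKn ?subn_gt0 // addn1 exprS.
have S1 : S 1%N = 1 - kloosterman m a.
  have := sum_norm1_psi hK hL iota a; rewrite (sum_psi_inv hK a0).
  rewrite (sum_psi_linear hK a0) mulr0 => /eqP; rewrite addr_eq0 => /eqP e.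
  by rewrite -[RHS]opprB -e; apply: eq_bigr => x _; rewrite expr1.
have S5 : S 5%N = 2 * \sum_t chi (qf m a t) - kloosterman m a + 1.
  have := sum_norm1_psi5 hK hL iota a; rewrite -/(S 5%N).
  (* As 5 divides q + 1, it does not divide q - 1; so x -> x^5 permutes K and the K-part of the sum
     for u^5 is that for u. *)
  have c5 : gcdz 5 (#|K|.-1)%:Z = 1.
    rewrite /gcdz /= hK -/q; congr (Posz _); apply/eqP.
    have := m5; rewrite -/q => q5; rewrite -[_ == _]/(coprime 5 q.-1).
    rewrite prime_coprime //; apply/negP => q5'.
    have : (5 %| (q + 1) - q.-1)%N by apply: dvdn_sub.
    by rewrite (_ : (q + 1 - q.-1 = 2)%N) //; move: q_gt1; lia.
  have inj5 : injective (fun x : K => x ^+ 5) by apply: (exprz_inj c5).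
  rewrite (_ : \sum_(x : K | x != 0) psi m (a * (x ^+ 5 + (x ^+ 5)^-1))
    = kloosterman m a - 1) => [<-|]; first by ring.
  rewrite -(sum_psi_inv hK a0) [RHS](reindex_inj inj5) /=; apply: eq_bigl => x.
  by rewrite expf_eq0.
rewrite /punctured_sum.
have chif x : x != 0 -> chi (f x) = 2 * (if x ^+ (#|L|.-1 %/ 5) == 1
    then psi (2 * m) (iota a * (x ^+ (q - 1)) ^+ 1) else 0)
    - psi (2 * m) (iota a * (x ^+ (q - 1)) ^+ 1).
  move=> x0; rewrite /f /f_a1 chiD hL -subn1 -/q expr1 chi_Tr4.
    by rewrite -/(psi _ _); case: ifP => _; ring.
  by rewrite -exprM divnK ?cardE ?dvdn_mull // -cardE subn1 -hL expf_card_pred.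
rewrite (eq_bigr _ chif) sumrB -mulr_sumr -big_mkcondr /=.
rewrite (Sk 1%N) S1.
rewrite (eq_bigl (fun x : L => x ^+ (#|L|.-1 %/ 5) == 1)) => [|x]; last first.
  case: eqVneq => [->|] //=; rewrite expr0n eq_sym.
  have : (0 < #|L|.-1 %/ 5)%N.
    by rewrite divn_gt0 // dvdn_leq // hL -subn1 cardE muln_gt0 subn_gt0 q_gt1 addn1.
  by case: (_ %/ _)%N => //= k _; rewrite oner_eq0.
have := sum_expr_dvd (fun z => psi (2 * m) (iota a * (z ^+ (q - 1)) ^+ 1)) dv5.
set T := (X in _ = _ * X) => e5; rewrite mulrBr mulrCA -[5]/(5%:R) -e5.
transitivity (2 * ((2 ^+ m - 1) * S 5%N) - 5%:R * ((2 ^+ m - 1) * (1 - kloosterman m a))).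
  congr (2 * _ - _); rewrite -(Sk 5%N); apply: eq_bigr => x _.
  by rewrite expr1 exprAC.
by rewrite S5; ring.
Qed.

(** After cancelling q - 1 the criterion reads 4 S + 3 Kl - 3 = 5. For i prime to #|L| - 1, x -> x^i
    is a permutation of L fixing 0, and f (x^i) is still invariant with the same sum. *)
Lemma hyperbent_f_a1 : (1 < m)%N -> a != 0 ->
  hyperbent (2 * m) f <-> 3 * kloosterman m a = 8 - 4 * \sum_t chi (qf m a t).
Proof.
move=> m1 a0.
have key : punctured_sum f = 2 ^+ m - 1
    <-> 3 * kloosterman m a = 8 - 4 * \sum_t chi (qf m a t).
  have q0 : 2 ^+ m - 1 != 0 :> int.
    by rewrite -natrX subr_eq0 (eqr_nat _ q 1) gtn_eqF.
  have := punctured_sum_f_a1 a0; move: (punctured_sum f) (kloosterman m a) (\sum_t _).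
  move=> s k t e; split=> [es|ek].
    move: e; rewrite es mulrC => /(mulfI q0) e5; apply/eqP; rewrite -subr_eq0.
    by apply/eqP; transitivity (4 * t + 3 * k - 3 - 5); [ring | rewrite -e5].
  by apply: (@mulfI _ 5) => //; rewrite e ek; ring.
rewrite -key -(bent_invariant f_a1_0 f_a1_invariant m1).
split=> [[] // | bf]; split=> // i gi.
have i0 : i != 0.
  apply: contra_eq_neq gi => ->; rewrite gcd0z gez0_abs; last first.
    by rewrite subr_ge0 exprn_ege1.
  rewrite -subr_eq0 -addrA -opprD subr_eq0 -natrX (eqr_nat _ _ 2).
  by rewrite -[2%N]/(2 ^ 1)%N eqn_exp2l //; lia.
have inj : injective (fun x : L => x ^ i).
  apply: exprz_inj i0; rewrite -gi hL -subn1; congr gcdz.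
  by rewrite -[LHS]natz natrB ?expn_gt0 // natrX.
apply/bent_invariant => //.
- by rewrite exp0rz (negPf i0) f_a1_0.
- by move=> y x y0; rewrite expfzMl -fmorphXz f_a1_invariant // expfz_neq0.
rewrite -((bent_invariant f_a1_0 f_a1_invariant m1).1 bf).
rewrite /punctured_sum [RHS](reindex_inj inj); apply: eq_bigl => x /=.
by rewrite expfz_eq0 i0.
Qed.
End Exponents.
End BentSums.

(** * Quadratic forms over F_2 *)

Section QuadraticForm.
Variables (V : finFieldType) (B : V -> V -> 'F_2) (Q : V -> 'F_2).
Hypotheses (BDl : forall x y z, B (x + y) z = B x z + B y z)
  (BC : forall x y, B x y = B y x) (Bxx : forall x, B x x = 0)
  (QD : forall x y, Q (x + y) = Q x + Q y + B x y).

Lemma addF2 (c : 'F_2) : c + c = 0.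
Proof. by apply/eqP; case: c => [[|[|]]]. Qed.

Lemma B0l y : B 0 y = 0.
Proof. by apply: (addIr (B 0 y)); rewrite -BDl addr0 add0r. Qed.

Lemma BDr x y z : B x (y + z) = B x y + B x z.
Proof. by rewrite BC BDl !(BC x). Qed.

Lemma Q0 : Q 0 = 0.
Proof. by apply: (addIr (Q 0)); rewrite add0r -{3}[0]addr0 QD B0l addr0. Qed.

Lemma BMnl x y n : B (x *+ n) y = B x y *+ n.
Proof. by elim: n => [|n IH]; rewrite ?mulr0n ?B0l // !mulrS BDl IH. Qed.

Lemma BMn0 x y n p : B x y = 0 -> B (x *+ n) (y *+ p) = 0.
Proof. by move=> xy; rewrite BMnl BC BMnl BC xy !mul0rn. Qed.

Lemma Bsuml (I : Type) (r : seq I) (P : pred I) (G : I -> V) y :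
  B (\sum_(i <- r | P i) G i) y = \sum_(i <- r | P i) B (G i) y.
Proof. by elim/big_rec2: _ => [|i u v _ <-]; rewrite ?B0l ?BDl. Qed.

Lemma mulrnF2 (c d : 'F_2) : c *+ (d : nat) = d * c.
Proof. by apply/eqP; case: d => [[|[|]]] //; case: c => [[|[|]]]. Qed.

Lemma sum_F2 (G : 'F_2 -> int) : \sum_b G b = G 0 + G 1.
Proof.
by rewrite (bigD1 0) // (bigD1 1) //= big1 ?addr0 // => -[[|[|b]] lt].
Qed.

Definition hyperbolic (k : nat) (e f : nat -> V) : Prop :=
  forall i j, (i < k)%N -> (j < k)%N ->
    [/\ B (e i) (e j) = 0, B (f i) (f j) = 0 & B (e i) (f j) = (i == j)%:R].

Section Combination.
Variables (k : nat) (e f : nat -> V) (hef : hyperbolic k e f).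

Definition hyp_comb (c : {ffun 'I_k -> 'F_2 * 'F_2}) : V :=
  \sum_(i < k) (e i *+ (c i).1 + f i *+ (c i).2).

Lemma B_hyp_comb_e c (j : 'I_k) : B (hyp_comb c) (e j) = (c j).2.
Proof.
rewrite Bsuml (bigD1 j) //= big1 ?addr0 => [|i ne].
  have [ee _ ef] := hef (ltn_ord j) (ltn_ord j).
  by rewrite BDl !BMnl ee mul0rn add0r BC ef eqxx mulrnF2 mulr1.
have [ee _ _] := hef (ltn_ord i) (ltn_ord j).
have [_ _ ef] := hef (ltn_ord j) (ltn_ord i).
by rewrite BDl !BMnl ee mul0rn add0r BC ef eq_sym val_eqE (negPf ne) mul0rn.
Qed.

Lemma B_hyp_comb_f c (j : 'I_k) : B (hyp_comb c) (f j) = (c j).1.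
Proof.
rewrite Bsuml (bigD1 j) //= big1 ?addr0 => [|i ne].
  have [_ ff ef] := hef (ltn_ord j) (ltn_ord j).
  by rewrite BDl !BMnl ff mul0rn addr0 ef eqxx mulrnF2 mulr1.
have [_ ff ef] := hef (ltn_ord i) (ltn_ord j).
by rewrite BDl !BMnl ff mul0rn addr0 ef val_eqE (negPf ne) mul0rn.
Qed.

Lemma hyp_comb_inj : injective hyp_comb.
Proof.
move=> c d ecd; apply/ffunP => j.
by rewrite [c j]surjective_pairing [d j]surjective_pairing -!B_hyp_comb_e -!B_hyp_comb_f ecd.
Qed.

Lemma Q_sum (I : eqType) (r : seq I) (G : I -> V) : uniq r ->
  {in r &, forall i j, i != j -> B (G i) (G j) = 0} ->
  Q (\sum_(i <- r) G i) = \sum_(i <- r) Q (G i).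
Proof.
elim: r => [|i r IH] /=; first by rewrite !big_nil Q0.
case/andP => ir ur h; rewrite !big_cons QD IH //; last first.
  by move=> x y xr yr; apply: h; rewrite inE ?xr ?yr orbT.
suff -> : B (G i) (\sum_(j <- r) G j) = 0 by rewrite addr0.
rewrite BC Bsuml big_seq big1 // => j jr.
by apply: h; rewrite ?inE ?eqxx ?jr ?orbT //; apply: contraNneq ir => <-.
Qed.

Lemma chi_Q_hyp_comb c :
  chi (Q (hyp_comb c)) = \prod_(i < k) chi (Q (e i *+ (c i).1 + f i *+ (c i).2)).
Proof.
rewrite Q_sum ?index_enum_uniq // => [|i j _ _ ne].
  by elim/big_rec2: _ => // i u v _ <-; rewrite chiD.
have [ee ff ef] := hef (ltn_ord i) (ltn_ord j).
have [_ _ fe] := hef (ltn_ord j) (ltn_ord i).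
have ij : (i == j :> nat) = false by rewrite val_eqE; apply: negPf.
rewrite ij in ef; rewrite eq_sym ij BC in fe.
by rewrite BDl !BDr !BMn0 ?addr0.
Qed.

(** The sum factors over the orthogonal hyperbolic planes. A plane contributes 1 + chi (Q e) + chi
    (Q f) + chi (Q e + Q f + 1), which is -2 if Q e = Q f = 1 and 2 otherwise. *)
Lemma sum_chi_hyp_comb :
  \sum_c chi (Q (hyp_comb c))
  = 2 ^+ k * (-1) ^+ #|[set i : 'I_k | (Q (e i) == 1) && (Q (f i) == 1)]|.
Proof.
rewrite (eq_bigr _ (fun c _ => chi_Q_hyp_comb c)).
rewrite -(bigA_distr_bigA (fun (i : 'I_k) (b : 'F_2 * 'F_2) =>
  chi (Q (e i *+ b.1 + f i *+ b.2)))) /=.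
have -> : (-1) ^+ #|[set i : 'I_k | (Q (e i) == 1) && (Q (f i) == 1)]|
  = \prod_(i < k) (if (Q (e i) == 1) && (Q (f i) == 1) then -1 else 1 : int).
  by rewrite -big_mkcond prodr_const cardsE.
rewrite -[2 ^+ k](_ : \prod_(i < k) 2 = _); last by rewrite prodr_const card_ord.
rewrite -big_split /=; apply: eq_bigr => i _.
have [_ _ ef] := hef (ltn_ord i) (ltn_ord i).
rewrite -(pair_bigA _ (fun b b' : 'F_2 => chi (Q (e i *+ b + f i *+ b')))) /=.
rewrite !sum_F2 !mulr0n !mulr1n !add0r !addr0 QD ef eqxx Q0.
by case: (Q (e i)) (Q (f i)) => [[|[|?]] ?] [[|[|?]] ?].
Qed.

Lemma sum_chi_Q : #|V| = (4 ^ k)%N ->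
  \sum_x chi (Q x)
  = 2 ^+ k * (-1) ^+ #|[set i : 'I_k | (Q (e i) == 1) && (Q (f i) == 1)]|.
Proof.
move=> hV; rewrite -sum_chi_hyp_comb; apply: (reindex hyp_comb).
apply/onW_bij/(inj_card_bij hyp_comb_inj).
by rewrite hV card_ffun card_prod !card_ord.
Qed.
End Combination.

Definition radical := [pred y : V | [forall x, B x y == 0]].

(** Symplectic Gram-Schmidt: as 4^k < 4^m, two vectors pair equally with the k planes already built,
    and their difference v is orthogonal to all of them. Some w pairs to 1 with v. *)
Lemma hyperbolic_exists m k : #|V| = (4 ^ m)%N -> (k <= m)%N ->
  (forall y, y \in radical -> y = 0) -> exists e f, hyperbolic k e f.
Proof.
move=> hV + rad0; elim: k => [|k IH] km; first by exists (fun=> 0), (fun=> 0).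
have [e [f hef]] := IH (ltnW km).
pose g v : {ffun 'I_k -> 'F_2 * 'F_2} := [ffun i : 'I_k => (B v (e i), B v (f i))].
have [|x [y [nxy exy]]] := @pigeonhole _ _ g.
  by rewrite hV card_ffun card_prod !card_ord ltn_exp2l.
pose v := x - y; have v0 : v != 0 by rewrite subr_eq0.
have Bv i : (i < k)%N -> B v (e i) = 0 /\ B v (f i) = 0.
  move=> ik; have /ffunP/(_ (Ordinal ik)) := exy; rewrite !ffunE /= => -[ee ff].
  have Bv0 z : B x z = B y z -> B v z = 0.
    by move=> exyz; apply: (addIr (B y z)); rewrite -BDl subrK add0r.
  by split; apply: Bv0.
have [w Bvw] : exists w, B v w = 1.
  have : v \notin radical by apply: contra v0 => /rad0 ->.
  case/forallPn => w; rewrite BC => nz; exists w.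
  by move: nz; case: (B v w) => [[|[|?]] lt] // _; apply/val_inj.
(* The coordinates of the projection of w on the planes: the coefficient of [e i] is read by pairing
   with [f i], and conversely. Adding it makes w orthogonal to them. *)
pose c : {ffun 'I_k -> 'F_2 * 'F_2} := [ffun i : 'I_k => (B w (f i), B w (e i))].
pose w' := w + hyp_comb e f c.
have Bw i : (i < k)%N -> B w' (e i) = 0 /\ B w' (f i) = 0.
  move=> ik; rewrite !BDl (B_hyp_comb_e hef c (Ordinal ik)) (B_hyp_comb_f hef c (Ordinal ik)).
  by rewrite ffunE /= !addF2.
have Bvw' : B v w' = 1.
  rewrite BC BDl (BC w) Bvw Bsuml big1 ?addr0 // => i _.
  have [ve vf] := Bv i (ltn_ord i).
  by rewrite BDl !BMnl !(BC _ v) ve vf !mul0rn addr0.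
exists (fun i => if (i < k)%N then e i else v), (fun i => if (i < k)%N then f i else w').
move=> i j; rewrite !ltnS => ik jk.
have [lik|lik] := ltnP i k; have [ljk|ljk] := ltnP j k.
- exact: hef.
- have [we wf] := Bw i lik; have [ve vf] := Bv i lik.
  by rewrite !(BC _ v) !(BC _ w') ve wf we ltn_eqF ?(leq_trans lik).
- have [we wf] := Bw j ljk; have [ve vf] := Bv j ljk.
  by rewrite ve wf vf gtn_eqF ?(leq_trans ljk).
have -> : i = j by apply/eqP; rewrite eqn_leq (leq_trans ik ljk) (leq_trans jk lik).
by rewrite !Bxx Bvw' eqxx.
Qed.

(** Writing the second variable as x + y, the square becomes the sum of chi (Q y) chi (B x y);
    summing over x keeps only y in the radical. There Q is additive, so the remaining sum is either
    0 or the size of the radical. *)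
Lemma sum_chi_Q_sqr : (\sum_x chi (Q x)) ^+ 2 = 0
  \/ (\sum_x chi (Q x)) ^+ 2 = (#|V| * #|radical|)%:R.
Proof.
have sumB y : \sum_x chi (B x y) = if y \in radical then #|V|%:R else 0.
  case: ifPn => [/forallP ry|].
    rewrite (eq_bigr (fun=> 1)) => [|x _]; last by rewrite (eqP (ry x)).
    by rewrite sumr_const.
  case/forallPn => z nz; have Bz : B z y = 1.
    by move: nz; case: (B z y) => [[|[|?]] lt] // _; apply/val_inj.
  have: \sum_x chi (B x y) = - \sum_x chi (B x y).
    rewrite {1}(reindex_inj (addIr z)) /= -sumrN; apply: eq_bigr => x _.
    by rewrite BDl Bz chiD mulrN1.
  by move/eqP; rewrite -addr_eq0 -mulr2n mulrn_eq0 => /eqP.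
have sqr : (\sum_x chi (Q x)) ^+ 2 = #|V|%:R * \sum_(y in radical) chi (Q y).
  rewrite expr2 mulr_suml.
  transitivity (\sum_x \sum_y chi (Q y) * chi (B x y)).
    apply: eq_bigr => x _; rewrite (reindex_inj (addrI x)) mulr_sumr /=.
    by apply: eq_bigr => y _; rewrite -!chiD QD !addrA addF2 add0r.
  rewrite exchange_big mulr_sumr [RHS]big_mkcond; apply: eq_bigr => y _ /=.
  by rewrite -mulr_sumr sumB; case: ifP; rewrite ?mulr0 // mulrC.
have [h|] := boolP [forall y in radical, Q y == 0].
  right; rewrite sqr natrM (eq_bigr (fun=> 1)) ?sumr_const // => y yr.
  by move/forall_inP: h => /(_ y yr)/eqP->.
rewrite negb_forall_in => /exists_inP[z zr Qz]; left; rewrite sqr.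
have {Qz} Qz : Q z = 1.
  by move: Qz; case: (Q z) => [[|[|?]] lt] // _; apply/val_inj.
have Bz x : B x z = 0 by apply/eqP; move/forallP: zr.
suff -> : \sum_(y in radical) chi (Q y) = 0 by rewrite mulr0.
have: \sum_(y in radical) chi (Q y) = - \sum_(y in radical) chi (Q y).
  rewrite {1}(reindex_inj (addIr z)) /= -sumrN; apply: eq_big => y.
    by apply: eq_forallb => x; rewrite BDr Bz addr0.
  by move=> _; rewrite QD Bz Qz addr0 chiD mulrN1.
by move/eqP; rewrite -addr_eq0 -mulr2n mulrn_eq0 => /eqP.
Qed.
End QuadraticForm.

(** * The radical of the trace form and the factors of the quintic *)

Section TraceForm.
Variables (m : nat) (K : finFieldType) (hK : #|K| = (2 ^ m)%N) (a : K).
Let ch2 : 2 \in [pchar K] := card_finPcharP hK (isT : prime 2).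
Implicit Types x y z : K.

Lemma qf_symplDl x y z :
  qf_sympl m a (x + y) z = qf_sympl m a x z + qf_sympl m a y z.
Proof.
rewrite /qf_sympl -(TrD hK); congr (Tr _ _).
by rewrite (exprD_pow2 ch2 _ _ 2) (exprD_pow2 ch2 _ _ 1); ring.
Qed.

Lemma qf_symplC x y : qf_sympl m a x y = qf_sympl m a y x.
Proof. by rewrite /qf_sympl addrC. Qed.

Lemma qf_symplxx x : qf_sympl m a x x = 0.
Proof. by rewrite /qf_sympl (addrr_pchar2 ch2) Tr0. Qed.

Lemma qfD x y : qf m a (x + y) = qf m a x + qf m a y + qf_sympl m a x y.
Proof.
rewrite /qf_sympl -!(TrD hK); congr (Tr _ _).
by rewrite (exprD_pow2 ch2 _ _ 2) (exprD_pow2 ch2 _ _ 1); ring.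
Qed.

(* Moving the x^4 and x^2 across the trace by Frobenius turns qf_sympl x u into  *)
(* Tr (x^4 * (a^4 u^16 + a^4 u^8 + a^2 u^2 + a u)).                              *)
Lemma qf_radical u :
  a ^+ 4 * u ^+ 16 + a ^+ 4 * u ^+ 8 + a ^+ 2 * u ^+ 2 + a * u = 0 ->
  u \in radical (qf_sympl m a).
Proof.
move=> hu; apply/forallP => x; apply/eqP.
have -> : qf_sympl m a x u
  = Tr m (a * x * u ^+ 4) + Tr m (a * x * u ^+ 2) + Tr m (a * u * x ^+ 4)
    + Tr m (a * u * x ^+ 2).
  rewrite /qf_sympl -!(TrD hK); congr (Tr _ _).
  rewrite -[RHS]addr0 -(addrr_pchar2 ch2 (a ^+ 2 * x * u)); ring.
rewrite -(Tr_expr_pow2 hK 2 (a * x * u ^+ 4)) -(Tr_expr_pow2 hK 2 (a * x * u ^+ 2)).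
rewrite -(Tr_expr_pow2 hK 1 (a * u * x ^+ 2)) -!(TrD hK).
rewrite -[RHS](Tr0 K m); congr (Tr _ _).
by rewrite -[RHS](mulr0 (x ^+ 4)) -hu; ring.
Qed.
End TraceForm.

Section Quintic.
Variables (F : fieldType) (ch2 : 2 \in [pchar F]) (a : F) (a0 : a != 0).
Let b := a^-1.
Let p : {poly F} := 'X^5 + 'X + b%:P.

Let rad_eq u := a ^+ 4 * u ^+ 16 + a ^+ 4 * u ^+ 8 + a ^+ 2 * u ^+ 2 + a * u = 0.

Let rad_eqE u :
  u ^+ 16 + u ^+ 8 + b ^+ 2 * u ^+ 2 + b ^+ 3 * u = 0 -> rad_eq u.
Proof.
move=> hu; rewrite /rad_eq -[RHS](mulr0 (a ^+ 4)) -hu /b.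
by field.
Qed.

Lemma size_quintic : size p = 6%N.
Proof.
rewrite /p -addrA size_polyDl size_polyXn // (leq_ltn_trans (size_polyD _ _)) //.
rewrite gtn_max size_polyX /=; apply: leq_ltn_trans (size_polyC_leq1 _) _.
by [].
Qed.

Lemma quintic_root_radical u : root p u -> u != 0 /\ rad_eq u.
Proof.
move=> /eqP; rewrite !hornerE /= => hu.
have hb : b = u ^+ 5 + u by apply/eqP; rewrite -(pchar2_eqE ch2) addrC hu.
split.
  apply: contraNneq (invr_neq0 a0) => u0.
  by move: hb; rewrite u0 expr0n addr0 /b => ->.
apply: rad_eqE; rewrite hb.
(* With b = u^5 + u substituted, every integer coefficient of the expression is even; [t] is half of
   it. *)
pose t := u ^+ 16 + 2 * u ^+ 12 + 3 * u ^+ 8 + u ^+ 4.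
transitivity (t + t); first by rewrite /t; ring.
exact: addrr_pchar2 ch2 t.
Qed.

(* u is the sum of two roots of p.                                              *)
Lemma quintic_quadratic_radical u v (r : {poly F}) :
  p = r * ('X^2 + u *: 'X + v%:P) -> u != 0 /\ rad_eq u.
Proof.
move=> e; pose d : {poly F} := 'X^2 + u *: 'X + v%:P.
have d0 : d`_0 = v by rewrite !coefE /= mulr0 !add0r.
have d1 : d`_1 = u by rewrite !coefE /= mulr1 add0r addr0.
have d2 : d`_2 = 1 by rewrite !coefE /= mulr0 !addr0.
have dn i : d`_i.+3 = 0 by rewrite !coefE /= mulr0 !addr0.
have pn i : p`_i = \sum_(j < i.+1) r`_j * d`_(i - j) by rewrite e coefM.
have sr : (size r <= 4)%N.
  have sd : size d = 3%N.
    rewrite /d -addrA size_polyDl size_polyXn // (leq_ltn_trans (size_polyD _ _)) //.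
    rewrite gtn_max (leq_ltn_trans (size_scale_leq _ _)) ?size_polyX //.
    exact: leq_ltn_trans (size_polyC_leq1 _) _.
  have r0 : r != 0.
    by apply/eqP => r0; have := size_quintic; rewrite e r0 mul0r size_poly0.
  have dn0 : d != 0 by rewrite -size_poly_eq0 sd.
  by have := size_quintic; rewrite e size_mul // sd; move: (size r); lia.
have r4 : r`_4 = 0 by rewrite nth_default.
have r5 : r`_5 = 0 by rewrite nth_default // (leq_trans sr).
have := pn 5; have := pn 4; have := pn 3; have := pn 2; have := pn 1%N; have := pn 0%N.
rewrite !big_ord_recr !big_ord0 /= !subSS !subn0 ?subnn.
rewrite !(dn, d0, d1, d2, r4, r5) !coefE /= !(mulr0, mul0r, add0r, addr0, mulr1).
move=> e0 e1 e2 e3 e4 e5.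
have {}e3 : 0 = r`_1 + r`_2 * u + r`_3 * v := e3.
have {}e4 : 0 = r`_2 + r`_3 * u := e4.
have {}e5 : 1 = r`_3 := e5.
have {}e1 : 1 = r`_0 * u + r`_1 * v := e1.
have r2 : r`_2 = u by apply/eqP; rewrite -(pchar2_eqE ch2) -[u]mul1r e5 -e4.
have r1 : r`_1 = u ^+ 2 + v.
  apply: (addIr (u ^+ 2 + v)); rewrite (addrr_pchar2 ch2) [RHS]e3 r2 -e5 addrA.
  by rewrite mul1r expr2.
have r0 : r`_0 = u ^+ 3.
  apply: (addIr (u ^+ 3)); rewrite (addrr_pchar2 ch2) [RHS]e2 r2 r1.
  rewrite -[LHS]addr0 -(addrr_pchar2 ch2 (u * v)); ring.
rewrite r0 in e0; rewrite r0 r1 in e1; split.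
  apply: contraNneq (invr_neq0 a0) => u0.
  by apply/eqP; rewrite -/b e0 u0 expr0n mul0r.
apply: rad_eqE; rewrite e0.
(* Here b = u^3 v, and with w = 1 + u^4 + u^2 v the expression is u^8 w (v^2 - w) up to the even
   part [t + t]. The coefficient of X in p gives v^2 = w. *)
pose t := u ^+ 8 * (u ^+ 8 + u ^+ 4 + u ^+ 2 * v * (1 + u ^+ 4) + 1).
transitivity ((t + t) + u ^+ 8 * (1 + u ^+ 4 + u ^+ 2 * v)
    * (v ^+ 2 - (1 + u ^+ 4 + u ^+ 2 * v))).
  by rewrite /t; ring.
suff -> : 1 + u ^+ 4 + u ^+ 2 * v = v ^+ 2.
  by rewrite (addrr_pchar2 ch2) add0r subrr mulr0.
rewrite e1.
transitivity (v ^+ 2 + (u ^+ 4 + u ^+ 4) + (u ^+ 2 * v + u ^+ 2 * v)); first by ring.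
by rewrite !(addrr_pchar2 ch2) !addr0.
Qed.

(** A proper factor of a quintic, or its cofactor, has degree 1 or 2. It yields a root of p or a sum
    of two roots, in both cases a nonzero solution of [rad_eq]. *)
Lemma irreducible_quintic :
  (forall u, rad_eq u -> u = 0) -> irreducible_poly p.
Proof.
move=> h; have sp := size_quintic; have p0 : p != 0 by rewrite -size_poly_eq0 sp.
have no2 (d : {poly F}) : d %| p -> size d != 2%N.
  move=> dp; apply/negP => /eqP/poly2_root[x rx].
  have rpx : root p x by have /dvdpP[r ->] := dp; rewrite rootM rx orbT.
  have [x0 /h ux] := quintic_root_radical rpx.
  by rewrite ux eqxx in x0.
have no3 (d : {poly F}) : d %| p -> size d != 3%N.
  move=> dp; apply/negP => /eqP sd.
  have c0 : d`_2 != 0.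
    by have := lead_coef_eq0 d; rewrite lead_coefE sd /= -size_poly_eq0 sd => ->.
  pose c := d`_2; pose u := d`_1 / c; pose v := d`_0 / c.
  have dE : d = c *: ('X^2 + u *: 'X + v%:P).
    apply/polyP => i; rewrite coefZ !coefE; case: i => [|[|[|i]]] /=.
    - by rewrite mulr0 !add0r mulrC divfK.
    - by rewrite mulr1 add0r addr0 mulrC divfK.
    - by rewrite mulr0 !addr0 mulr1.
    - by rewrite mulr0 !addr0 mulr0 nth_default ?sd.
  have /dvdpP[r er] := dp.
  have [u0 /h uz] : u != 0 /\ rad_eq u.
    apply: (@quintic_quadratic_radical u v (c *: r)).
    by rewrite er {1}dE -scalerAr -scalerAl.
  by rewrite uz eqxx in u0.
split; first by rewrite sp.
move=> d sd dp; rewrite -dvdp_size_eqp // sp.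
have /dvdpP[r er] := dp; have rp : r %| p by rewrite er dvdp_mulr.
have dn0 : d != 0 by apply: contraNneq p0 => d0; rewrite er d0 mulr0.
have rn0 : r != 0 by apply: contraNneq p0 => r0; rewrite er r0 mul0r.
have := sp; rewrite er size_mul //; move: sd (no2 _ dp) (no3 _ dp) (no2 _ rp) (no3 _ rp).
move: dn0 rn0; rewrite -!size_poly_eq0; move: (size d) (size r) => i j; lia.
Qed.
End Quintic.

(** * The bound on the Kloosterman sum and the exclusion of large S *)

Section Bound.
Variables (m : nat) (K L : finFieldType).
Hypotheses (hK : #|K| = (2 ^ m)%N) (hL : #|L| = (2 ^ (2 * m))%N).
Variable iota : {rmorphism K -> L}.

(** By [sum_psi_lift], (Kl - 1)^2 is 2 q minus the punctured Kloosterman sum over L. The latter is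
    q^2 - 1 - 2 M, where M counts the arguments of trace 1, so Stepanov's upper bound on M is the
    one required. *)
Lemma kloosterman_bound (a : K) : a != 0 -> (2 < m)%N ->
  (kloosterman m a - 1) ^+ 2 < 6 * 2 ^+ m.
Proof.
move=> a0 m2; case: m m2 hK hL => // j j1 hK' hL'.
have := sum_psi_lift hK' hL' iota a0.
have -> : \sum_(x : K | x != 0) psi j.+1 (a * x + x^-1) = kloosterman j.+1 a - 1.
  rewrite /kloosterman [X in X - 1](bigD1 0) //= invr0 mulr0 addr0.
  by rewrite -/(psi j.+1 0) psi0 [1 + _]addrC addrK.
have ia0 : iota a != 0 by rewrite fmorph_eq0.
have := card_kloosterman_trace1 hL' ia0 j1.
set M := #|_| => hM.
have -> : \sum_(x : L | x != 0) psi (2 * j.+1) (iota a * x + x^-1)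
    = (2 ^ (2 * j.+1))%:R - 1 - 2 * M%:R.
  have chiE t : chi t = 1 - 2 * (t == 1)%:R by case: t => [[|[|?]] ?].
  rewrite (eq_bigr _ (fun x _ => chiE _)) sumrB sumr_const -mulr_sumr -natr_sum.
  rewrite (cardC1 (0 : L)) hL' -subn1 natrB ?expn_gt0 //; congr (_ - 2 * _%:R).
  by rewrite /M -sum1_card [RHS]big_mkcondr /=; apply: eq_bigr => x _; case: eqP.
have -> : (2 ^ (2 * j.+1) = 4 * (2 ^ j) ^ 2)%N.
  by rewrite -expnM -(expnD 2 2); congr (_ ^ _)%N; lia.
rewrite -natrX (expnS 2 j); move: (kloosterman _ _ - 1) (2 ^ j)%N M hM => S h M hM.
rewrite !natz => e.
move: (S ^+ 2) (h ^ 2)%N hM e => S2 H hM e.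
have eS : S2 = 4 * h%:Z - 4 * H%:Z + 1 + 2 * M%:Z by lia.
have hM' : M%:Z + 1 <= 2 * H%:Z + 4 * h%:Z by lia.
by rewrite eS; lia.
Qed.
End Bound.

(** The quotient r is itself a perfect square, so r >= 2 forces its root to be at least 2. *)
Lemma large_square (s r : nat) (S : int) : (0 < s)%N -> (2 <= r)%N ->
  S ^+ 2 = (s ^ 2 * r)%N -> 2 * s%:Z <= S \/ 2 * s%:Z <= - S.
Proof.
move=> s0 r2 e; have eN : (`|S| ^ 2 = s ^ 2 * r)%N.
  by apply/eqP; rewrite -eqz_nat -e -abszX; case: (S ^+ 2) (sqr_ge0 S).
have /dvdnP[t et] : (s %| `|S|)%N by rewrite -(@dvdn_pexp2r _ _ 2) // eN dvdn_mulr.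
have tr : (t ^ 2 = r)%N.
  apply/eqP; rewrite -(eqn_pmul2l (_ : 0 < s ^ 2)%N) ?expn_gt0 ?s0 //.
  by rewrite -eN et expnMn mulnC.
have t2 : (2 <= t)%N by move: r2; rewrite -tr; case: t {et tr} => [|[|]].
have : (2 * s <= `|S|)%N by rewrite et leq_mul2r t2 orbT.
lia.
Qed.

(** Here (8 s - 5)^2 <= 9 k^2 < 54 s^2 would give 10 s^2 + 25 < 80 s, impossible for s >= 8. With s
    = 2^m1 this is where m1 >= 3 enters. *)
Lemma large_square_absurd (s k S : int) : 8 <= s -> k ^+ 2 < 6 * s ^+ 2 ->
  9 * k ^+ 2 = (4 * S - 5) ^+ 2 -> 2 * s <= S \/ 2 * s <= - S -> False.
Proof.
move=> s8 bk eS hS.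
have w : (8 * s - 5) ^+ 2 <= (4 * S - 5) ^+ 2.
  rewrite -subr_ge0 subr_sqr; case: hS => hS; first by apply: mulr_ge0; lia.
  by apply: mulr_le0; lia.
have : 0 <= s * (s - 8) by apply: mulr_ge0; lia.
have : 9 * k ^+ 2 < 9 * (6 * s ^+ 2) by rewrite ltr_pM2l.
have -> : s * (s - 8) = s ^+ 2 - 8 * s by ring.
move: w; rewrite -eS (_ : (8 * s - 5) ^+ 2 = 64 * s ^+ 2 - 80 * s + 25); last by ring.
by move: (k ^+ 2) (s ^+ 2) => k2 s2; lia.
Qed.

(** * From hyperbolic pairs to a symplectic basis *)

Section SymplecticBasis.
Variables (F : finFieldType) (ch2 : 2 \in [pchar F]) (B : F -> F -> 'F_2).
Hypotheses (BDl : forall x y z, B (x + y) z = B x z + B y z)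
  (BC : forall x y, B x y = B y x).
Variables (k : nat) (e f : nat -> F) (hef : hyperbolic B k e f).

Definition interleave : (2 * k).-tuple (pPrimeCharType ch2) :=
  [tuple if (i < k)%N then e i else f (i - k)%N | i < 2 * k].

Lemma nth_interleave i : (i < 2 * k)%N ->
  interleave`_i = if (i < k)%N then e i else f (i - k)%N.
Proof. by move=> ik; rewrite -[i]/(nat_of_ord (Ordinal ik)) -tnth_nth tnth_mktuple. Qed.

Lemma B_interleave i j : (i < 2 * k)%N -> (j < 2 * k)%N ->
  B interleave`_i interleave`_j = ((i == j + k) || (j == i + k))%N%:R.
Proof.
move=> ik jk; rewrite !nth_interleave //.
have [lik|lik] := ltnP i k; have [ljk|ljk] := ltnP j k.
- by have [-> _ _] := hef lik ljk; rewrite !ltn_eqF ?ltn_addl.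
- have jk' : (j - k < k)%N by lia.
  have [_ _ ->] := hef lik jk'; congr (nat_of_bool _)%:R.
  by apply/idP/idP; lia.
- have ik' : (i - k < k)%N by lia.
  rewrite BC; have [_ _ ->] := hef ljk ik'; congr (nat_of_bool _)%:R.
  by apply/idP/idP; lia.
have ik' : (i - k < k)%N by lia.
have jk' : (j - k < k)%N by lia.
have [_ -> _] := hef ik' jk'; rewrite (_ : (_ || _) = false) //; apply/negP; lia.
Qed.

Lemma free_interleave : free interleave.
Proof.
apply/freeP => c c0 i.
(* The index of the partner of the i-th vector; pairing a linear relation with the partner isolates
   [c i]. *)
pose i' := if (i < k)%N then (i + k)%N else (i - k)%N.
have ik := ltn_ord i; have i'k : (i' < 2 * k)%N by rewrite /i'; case: (ltnP i k); lia.
have : B (\sum_(j < 2 * k) c j *: interleave`_j) interleave`_i' = 0.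
  by rewrite c0 (B0l BDl).
rewrite (Bsuml BDl) (bigD1 i) //= big1 ?addr0 => [|j ne].
  rewrite [c i *: _]mulr_natl (BMnl BDl) B_interleave // mulrnF2.
  by rewrite (_ : (_ || _) = true) ?mulr1 // /i'; case: (ltnP i k); lia.
rewrite [c j *: _]mulr_natl (BMnl BDl) B_interleave //.
rewrite (_ : (_ || _) = false) ?mul0rn //.
have jk := ltn_ord j; move: ne; rewrite -val_eqE /= /i'.
by case: (ltnP i k); lia.
Qed.

Lemma symplectic_basis_interleave : #|F| = (2 ^ (2 * k))%N ->
  symplectic_basis (V := pPrimeCharType ch2) B interleave.
Proof.
move=> hF; split.
- rewrite basisEfree free_interleave subvf /= size_tuple.
  have dE := @pprimeChar_dimf 2 F ch2; rewrite hF pfactorK // in dE.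
  by rewrite card_ord; apply: eq_leq.
- move=> i j ik jk ne; rewrite B_interleave //.
  case: (_ =P _) => [ei|_] /=; first by rewrite ei modnDr eqxx in ne.
  by case: (_ =P _) => [ej|//]; rewrite ej modnDr eqxx in ne.
move=> i ik; rewrite B_interleave; [|lia|lia].
by rewrite [(k + i)%N]addnC eqxx orbT.
Qed.
End SymplecticBasis.

Theorem theorem2 (n m m1 : nat)
    (hn : n = (2 * m)%N) (hm : m = (2 * m1)%N)
    (hm1 : (m1 = 1 %[mod 2])%N) (hm13 : (3 <= m1)%N)
    (K L : finFieldType) (hK : #|K| = (2 ^ m)%N) (hL : #|L| = (2 ^ n)%N)
    (iota : {rmorphism K -> L}) (a : K) (ha : a != 0) :
  hyperbent n (f_a1 iota m n a) <->
  [/\ irreducible_poly ('X^5 + 'X + (a^-1)%:P),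
      qf_even (card_finPcharP hK (isT : prime 2)) m1 a
    & (kloosterman m a)%:~R = 4%:R / 3%:R * (2%:R - 2%:R ^+ m1) :> rat].
Proof.
subst n m; have ch2 : 2 \in [pchar K] := card_finPcharP hK (isT : prime 2).
have odd1 : odd m1 by move: hm1; rewrite !modn2; case: (odd m1).
(* For odd m1, 4^m1 = -1 mod 5. *)
have m5 : (5 %| 2 ^ (2 * m1) + 1)%N.
  rewrite expnM -[m1]odd_double_half odd1 -mul2n expnD expnM /dvdn.
  by rewrite -modnDml -modnMmr -modnXm exp1n.
have m2 : (2 < 2 * m1)%N by lia.
have h4 : #|K| = (4 ^ m1)%N by rewrite hK expnM.
have s8 : (8 <= 2 ^ m1)%N by rewrite -[8%N]/(2 ^ 3)%N leq_exp2l.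
rewrite (hyperbent_f_a1 hK hL iota m5 (ltnW m2) ha).
have klE : (kloosterman (2 * m1) a)%:~R = 4%:R / 3%:R * (2%:R - 2%:R ^+ m1) :> rat
    <-> 3 * kloosterman (2 * m1) a = 8 - 4 * 2 ^+ m1.
  have -> : 2%:R ^+ m1 = (2 ^+ m1 : int)%:~R :> rat by rewrite rmorphXn.
  move: (kloosterman _ a) (2 ^+ m1 : int) => k s; split=> [e|e].
    by apply: (@intr_inj rat); rewrite intrB !intrM e; field.
  have : (3 * k)%:~R = (8 - 4 * s)%:~R :> rat by rewrite e.
  rewrite intrB !intrM => e'; apply: (@mulfI _ 3%:R) => //.
  by rewrite [LHS]e'; field.
have BDl := qf_symplDl hK a; have BC := @qf_symplC (2 * m1) K a.
have Bxx := qf_symplxx hK a; have QD := qfD hK a.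
have BQ := sum_chi_Q BDl BC QD _ h4.
split=> [kl|[_ [e [_ Be Be1] ev] /klE kl]]; last first.
  have hyp : hyperbolic (qf_sympl (2 * m1) a) m1
      (fun i => e`_i : K) (fun i => e`_(m1 + i) : K).
    move=> i j ik jk; have [-> | ne] := eqVneq i j.
      by rewrite !Bxx; split=> //; apply: Be1.
    have ne' : (i != j %[mod m1])%N by rewrite !modn_small.
    have [li lj] : (i < 2 * m1)%N /\ (j < 2 * m1)%N by lia.
    by split; apply: Be; rewrite ?modnDl //; lia.
  by rewrite kl (BQ _ _ hyp) -signr_odd (negPf ev) expr0 mulr1.
have Qs := sum_chi_Q_sqr BDl BC QD.
set S := \sum_t _ in kl Qs.
have rad0 y : y \in radical (qf_sympl (2 * m1) a) -> y = 0.
  move=> yr; apply/eqP/negPn/negP => y0.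
  have r2 : (2 <= #|radical (qf_sympl (2 * m1) a)|)%N.
    apply/card_gt1P; exists 0, y; split=> //; last by rewrite eq_sym.
    by apply/forallP => x; rewrite BC (B0l BDl).
  case: Qs => [/eqP|Qs].
    (* S = 0 would give 3 Kl = 8. *)
    by rewrite sqrf_eq0 => /eqP S0; move: kl; rewrite S0; lia.
  have bound := kloosterman_bound hK hL iota ha m2.
  have S2 : S ^+ 2 = ((2 ^ m1) ^ 2 * #|radical (qf_sympl (2 * m1) a)|)%N.
    by rewrite Qs natz h4 -[4%N]/(2 ^ 2)%N expnAC.
  have bnd : 9 * (kloosterman (2 * m1) a - 1) ^+ 2 = (4 * S - 5) ^+ 2.
    have -> : 4 * S - 5 = - (3 * (kloosterman (2 * m1) a - 1)).
      by rewrite mulrBr kl; ring.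
    by ring.
  have hS := large_square (leq_trans (isT : 0 < 8)%N s8) r2 S2.
  apply: large_square_absurd _ _ bnd hS; first by move: s8; lia.
  suff <- : 2 ^+ (2 * m1) = (2 ^ m1)%N%:Z ^+ 2 by [].
  by rewrite mulnC exprM -natrX natz.
have [e [f hef]] := hyperbolic_exists BDl BC Bxx h4 (leqnn m1) rad0.
have SE := BQ _ _ hef; rewrite -/S -signr_odd in SE.
have ev : ~~ odd #|[set i : 'I_m1 | (qf (2 * m1) a (e i) == 1)
    && (qf (2 * m1) a (f i) == 1)]|.
  (* An odd form would give 3 Kl = 8 + 4 * 2^m1, which is 1 mod 3, because 2^m1 = 2 mod 3 for odd
     m1. *)
  apply/negP => od; move: SE kl; rewrite od expr1 mulrN1 => -> kl.
  have : (2 ^ m1 %% 3 = 2)%N.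
    rewrite -[m1]odd_double_half odd1 -mul2n expnD expnM.
    by rewrite -modnMmr -modnXm exp1n.
  move: kl; rewrite -natrX natz; move: (2 ^ m1)%N (kloosterman _ a) => s k; lia.
split.
- apply: (irreducible_quintic ch2 ha) => u hu.
  by apply: rad0; apply: (qf_radical hK hu).
- exists (interleave (card_finPcharP hK (isT : prime 2)) m1 e f).
    exact: symplectic_basis_interleave.
  rewrite (eq_card (B := mem [set i : 'I_m1 | (qf (2 * m1) a (e i) == 1)
    && (qf (2 * m1) a (f i) == 1)])) // => i.
  have ik := ltn_ord i; rewrite !inE !nth_interleave; [|lia..].
  by rewrite ik ltnNge leq_addr /= addKn.
by apply/klE; rewrite kl SE (negPf ev) expr0 mulr1.
Qed.
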